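(* Let $n\ge1$, and suppose $g\in\mathcal{C}$ is extremal. Let $\mu$ be a Borel probability measure on $\mathcal{C}$ such that $\int_{\mathcal{C}}f(z)\,d\mu(f)=g(z)$ for all $z\in\mathbb{H}^n$. Then $\mu=\delta_g$, the Dirac measure concentrated at $g$.
   Context: $\mathbb{H}$ is the upper half-plane. $\mathcal{C}$ is the family of holomorphic maps $f:\mathbb{H}^n\to\mathbb{H}$ such that $f(\lambda,\ldots,\lambda)=\lambda$ and $\frac{\partial f}{\partial z_j}(\lambda,\ldots,\lambda)=\frac1n$ for all $\lambda\in\mathbb{H}$ and $j=1,\ldots,n$, with the compact-open topology (in which $\mathcal{C}$ is compact and metrizable, and each evaluation $f\mapsto f(z)$ is continuous, hence $\mu$-integrable). A holomorphic map $g:\mathbb{H}^n\to\mathbb{H}$ is extremal if $\sum_{j=1}^n\operatorname{Im}(z_j)\left|\frac{\partial g}{\partial z_j}(z)\right|=\operatorname{Im}g(z)$ for all $z=(z_1,\ldots,z_n)\in\mathbb{H}^n$. *)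

(* Defs.v *)
From HB Require Import structures.
From mathcomp Require Import all_boot all_order all_algebra.
From mathcomp Require Import all_classical all_reals all_analysis.
From mathcomp Require Import complex.

Set Implicit Arguments.
Unset Strict Implicit.
Unset Printing Implicit Defensive.

Import Order.TTheory GRing.Theory Num.Theory.
Import numFieldNormedType.Exports.

Local Open Scope classical_set_scope.
Local Open Scope ring_scope.
Local Open Scope complex_scope.

(* The usual topology of the complex plane, so that differentiability of maps
   between R[i]-normed modules is complex differentiability. The unqualified
   names Re and Im are the R[i]-valued ones of numClosedFieldType; complex.Re
   and complex.Im are the real-valued projections. *)
HB.instance Definition _ (R : realType) := NormedModule.copy R[i] (R[i])^o.

Definition halfplane (R : realType) : set R[i] := [set z | 0 < complex.Im z].
Arguments halfplane : clear implicits.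

Definition polyhalfplane (R : realType) (n : nat) : set 'rV[R[i]]_n :=
  [set z | forall j, halfplane R (z 0 j)].
Arguments polyhalfplane : clear implicits.

(* All functions H^n -> H, with the topology generated by the sets
   {f | f(K) is included in O}, for K compact in H^n and O open in H; H^n and H
   are subtypes carrying the induced topologies. *)
Definition maps (R : realType) (n : nat) :=
  {compact-open, polyhalfplane R n -> halfplane R}.
Arguments maps : clear implicits.

Section maps.
Context {R : realType} {n : nat}.
Implicit Type f : maps R n.

(* f seen as a function on C^n, with value 0 outside of H^n. As H^n is open,
   neither differentiability nor partial derivatives at a point of H^n depend
   on the values outside of H^n. *)
Definition ext f : 'rV[R[i]]_n -> R[i] := valL_ 0 (set_val \o f).

Definition holomorphic f : Prop :=
  forall z, polyhalfplane R n z -> differentiable (ext f) z.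

Definition partial f (j : 'I_n) (z : 'rV[R[i]]_n) : R[i] :=
  'D_(delta_mx 0 j) (ext f) z.

(* The equality between real numbers is stated in R[i], where the modulus
   `|x| takes its values. *)
Definition extremal f : Prop :=
  holomorphic f /\
  forall z, polyhalfplane R n z ->
    \sum_(j < n) (complex.Im (z 0 j))%:C * `|partial f j z|
    = (complex.Im (ext f z))%:C.

End maps.

Definition classC (R : realType) (n : nat) : set (maps R n) :=
  [set f | [/\ holomorphic f,
    forall l, halfplane R l -> ext f (const_mx l) = l &
    forall l j, halfplane R l -> partial f j (const_mx l) = n%:R^-1]].
Arguments classC : clear implicits.

(* The topology of set_type (classC R n) is the one induced by maps R n. *)
Definition classC_type (R : realType) (n : nat) : Type := classC R n.
Arguments classC_type : clear implicits.

HB.instance Definition _ (R : realType) (n : nat) :=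
  Topological.copy (classC_type R n) (classC R n : Type).

Lemma extE (R : realType) (n : nat) (f : maps R n) (z : 'rV[R[i]]_n)
  (Hz : polyhalfplane R n z) : ext f z = set_val (f (SigSub (mem_set Hz))).
Proof.
have /(congr1 (fun h => h (set_val \o f) (SigSub (mem_set Hz)))) :=
  @sigL_valL _ _ (0 : R[i]) (polyhalfplane R n).
by rewrite /ext /=.
Qed.

Lemma open_halfplane (R : realType) : open (halfplane R).
Proof.
rewrite openE => z z0; apply/nbhs_ballP; exists (complex.Im z)%:C.
  by rewrite /= ltcR.
move=> w; rewrite -ball_normE /ball_ /= normc_def ltcR => zw.
have : `|complex.Im (z - w)| < complex.Im z.
  apply: le_lt_trans zw; rewrite -sqrtr_sqr ler_sqrt ?lerDr ?sqr_ge0//.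
  by rewrite addr_ge0 ?sqr_ge0.
rewrite raddfB /= ltr_norml => /andP[_].
by rewrite ltrBlDl ltrDr.
Qed.

Lemma open_polyhalfplane (R : realType) (n : nat) : open (polyhalfplane R n).
Proof.
rewrite openE => z Hz.
have Hj j : nbhs z (fun w : 'rV[R[i]]_n => halfplane R (w 0 j)).
  exact: (@coord_continuous R[i] 1 n 0 j z)
    (open_nbhs_nbhs (conj (@open_halfplane R) (Hz j))).
exact: filter_forall Hj.
Qed.

Lemma near_eq_differentiable (K : numFieldType) (V W : normedModType K)
  (f g : V -> W) (a : V) :
  (\near a, f a = g a) -> differentiable g a -> differentiable f a.
Proof.
move=> fg /diff_locallyP[cg dg].
have fga : f a = g a by exact: nbhs_singleton fg.
have df : f \o shift a = cst (f a) + 'd g a +o_ 0 id.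
  apply/eqaddoP => e e0; move/eqaddoP : dg => /(_ e e0).
  have fg0 : \forall h \near 0, f (h + a) = g (h + a).
    have : h + a @[h --> 0] --> a.
      by rewrite -[X in _ --> X]add0r; apply: cvgD; [exact: cvg_id|exact: cvg_cst].
    by move=> /(_ _ fg).
  by apply: filterS2 fg0 => h; rewrite !fctE /= => ->; rewrite fga.
have dE := diff_unique cg df.
by apply/diff_locallyP; rewrite dE.
Qed.

(* Measurable types are pointed in MathComp-Analysis, so an element of C is
   needed: the arithmetic mean of the coordinates. *)
Section mean.
Context {R : realType} {n : nat}.

Definition mean (z : 'rV[R[i]]_n.+1) : R[i] :=
  \sum_j (n.+1%:R^-1 : R)%:C * z 0 j.

Lemma mean_halfplane z : polyhalfplane R n.+1 z -> halfplane R (mean z).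
Proof.
move=> Hz; rewrite /halfplane /= /mean raddf_sum /=.
rewrite (eq_bigr (fun j => n.+1%:R^-1 * complex.Im (z 0 j))); last first.
  by move=> j _; case: (z 0 j) => a b /=; rewrite mul0r addr0.
rewrite -mulr_sumr mulr_gt0 ?invr_gt0 ?ltr0n//.
by rewrite big_ord_recl ltr_pwDl ?sumr_ge0// => [|j _]; [|apply: ltW]; apply: Hz.
Qed.

Lemma mean_const l : mean (const_mx l) = l.
Proof.
rewrite /mean (eq_bigr (fun=> (n.+1%:R^-1 : R)%:C * l)) => [|j _]; last first.
  by rewrite mxE.
rewrite sumr_const card_ord -mulrnAl -rmorphMn/= -mulr_natr mulVf ?pnatr_eq0//.
by rewrite mul1r.
Qed.

Lemma mean_is_linear : scalar mean.
Proof.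
move=> a u v; rewrite /mean /= mulr_sumr -big_split /=; apply: eq_bigr => j _.
by rewrite !mxE mulrDr mulrCA.
Qed.
HB.instance Definition _ :=
  GRing.isLinear.Build R[i] 'rV[R[i]]_n.+1 R[i] *%R mean mean_is_linear.

Lemma mean_continuous : continuous mean.
Proof.
apply: continuous_big => [|j _ z]; first exact: add_continuous.
exact: cvgMl_tmp (@coord_continuous R[i] 1 n.+1 0 j z).
Qed.

Definition mean_map : maps R n.+1 := fun z =>
  SigSub (mem_set (mean_halfplane (set_valP z))).

Lemma ext_meanE z : polyhalfplane R n.+1 z -> ext mean_map z = mean z.
Proof. by move=> Hz; rewrite extE. Qed.

Lemma near_ext_mean z : polyhalfplane R n.+1 z ->
  \near z, ext mean_map z = mean z.
Proof.
move=> Hz; apply: filterS (open_nbhs_nbhs (conj (@open_polyhalfplane R _) Hz)).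
exact: ext_meanE.
Qed.

Lemma differentiable_mean z : differentiable mean z.
Proof. exact: (linear_differentiable (f := mean) z mean_continuous). Qed.

Lemma mean_classC : classC R n.+1 mean_map.
Proof.
split=> [z Hz|l Hl|l j Hl].
- exact: near_eq_differentiable (near_ext_mean Hz) (differentiable_mean z).
- by rewrite ext_meanE ?mean_const// => j; rewrite mxE.
- have Hcl : polyhalfplane R n.+1 (const_mx l) by move=> k; rewrite mxE.
  rewrite /partial (near_eq_derive _ (near_ext_mean Hcl)) deriveE; last first.
    exact: differentiable_mean.
  rewrite (diff_lin (f := mean) _ mean_continuous) /= /mean (bigD1 j) //= big1.
    by rewrite mxE !eqxx mulr1 addr0 fmorphV rmorph_nat.
  by move=> k kj; rewrite mxE (negbTE kj) andbF mulr0.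
Qed.

End mean.

HB.instance Definition _ (R : realType) (n : nat) :=
  isPointed.Build (classC_type R n.+1) (SigSub (mem_set mean_classC)).

(* C with its Borel sigma-algebra. *)
Definition borelC (R : realType) (n : nat) :=
  g_sigma_algebraType (@open (classC_type R n)).
Arguments borelC : clear implicits.

HB.instance Definition _ (R : realType) (n : nat) :=
  Measurable.on (borelC R n.+1).

Definition complex_integral d (T : measurableType d) (R : realType)
    (mu : {measure set T -> \bar R}) (f : T -> R[i]) : R[i] :=
  (\int[mu]_x complex.Re (f x)) +i* (\int[mu]_x complex.Im (f x)).

(* Main.v *)
(* Fix z and let u_j be unimodular with u_j (d_j g)(z) = |(d_j g)(z)|. The disc
   psi_j(b) = (z_j - conj(z_j) u_j b) / (1 - u_j b) passes through z at b = 0, and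
   for f in C the function F = f o psi maps the unit disc to H, so that
   Im F(-s) >= (1 - s)^2 Im F(0). Dividing the difference by s and integrating
   over f, the limit s -> 0 vanishes because g is extremal; by Fatou's lemma
   Re sum_j Im(z_j) u_j (d_j f)(z) = Im f(z) for almost every f. The Schwarz-Pick
   inequality sum_j Im(z_j) |(d_j f)(z)| <= Im f(z) then forces d_j f(z) to have
   the argument of d_j g(z). Almost surely this holds on a countable dense set,
   hence everywhere. Near the diagonal point (i, ..., i), where
   d_j f = d_j g = 1/n, the ratio d_j f / d_j g is therefore real and holomorphic,
   hence equal to 1, and f = g there; the identity theorem gives f = g.

   All the function theory needed follows from the mean value property, obtained
   from Goursat's bisection in the coordinates s + i t = log(z). *)

Require Import Defs.
From mathcomp Require Import all_boot all_order all_algebra.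
From mathcomp Require Import all_classical all_reals all_analysis.
From mathcomp Require Import complex.
From mathcomp Require Import measurable_realfun.
From mathcomp Require Import ring lra.
Import Order.TTheory GRing.Theory Num.Theory.
Import numFieldNormedType.Exports.

Set Implicit Arguments.
Unset Strict Implicit.
Unset Printing Implicit Defensive.

Local Open Scope classical_set_scope.
Local Open Scope ring_scope.

(** * Integrals of continuous functions and Goursat's lemma *)

Section interval_integral.
Context {R : realType}.
Implicit Types (p q P : R -> R) (a b c k M : R).

(** The measure only gives access to evaluations, so the partial derivatives of the maps in [classC]
    are never integrated. A [harnack_gap] involves two evaluations only, so its mean is known
    exactly, and its sign is what Fatou's lemma asks for in place of a dominating function. The
    factor [(1 - s)^2] has the same expansion [1 - 2 s] to first order as the sharp Harnack factor
    [(1 - s) / (1 + s)], and the limit sees nothing else. The null set obtained at a point depends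
    on that point, hence the countable dense set. The partial derivatives of [g] may vanish away
    from the diagonal, so the phase condition is the vanishing of the imaginary part of [d_j f]
    times the conjugate of [d_j g]; a ratio is formed only near a diagonal point. Holomorphy means
    complex differentiability at each point: even the continuity of the partial derivatives has to
    be derived, through Taylor estimates, from Goursat's lemma. *)

Definition ointegral p a b : R := \int[lebesgue_measure]_(t in `[a, b]) p t.
Local Notation J := ointegral.

Lemma ointegral_FTC p P a b : a < b -> continuous p ->
  (forall x, a <= x <= b -> is_derive x 1 P (p x)) -> J p a b = P b - P a.
Proof.
move=> ab cp dP; rewrite /J /Rintegral (@continuous_FTC2 _ p P)//.
- exact: continuous_subspaceT.
- split.
  + by move=> x /[!in_itv]/= /andP[ax xb]; have := dP x; rewrite !ltW// => /(_ isT) [].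
  + apply: cvg_at_right_filter; apply/differentiable_continuous/derivable1_diffP.
    by have := dP a; rewrite lexx ltW// => /(_ isT) [].
  + apply: cvg_at_left_filter; apply/differentiable_continuous/derivable1_diffP.
    by have := dP b; rewrite lexx ltW// => /(_ isT) [].
- move=> x /[!in_itv]/= /andP[ax xb]; rewrite derive1E.
  by have := dP x; rewrite !ltW// => /(_ isT) [].
Qed.

(** One primitive serves all subintervals, which reduces linearity and additivity of the integral to
    algebra. Integration starts at [a - 1] so that [P] has a two-sided derivative at [a] as well. *)
Lemma primitive_exists p a : continuous p ->
  exists P, (forall x, a <= x -> is_derive x 1 P (p x)) /\
    forall c d, a <= c -> c < d -> J p c d = P d - P c.
Proof.
move=> cp; pose P x := \int[lebesgue_measure]_(t in `[a - 1, x]) p t.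
have dP x : a <= x -> is_derive x 1 P (p x).
  move=> ax; have [||//||d1 d2] := @continuous_FTC1_closed _ p (a - 1) x (x + 1).
  - by rewrite ltrDl.
  - apply: continuous_compact_integrable; first exact: segment_compact.
    exact: continuous_subspaceT.
  - by rewrite ltrBlDr (le_lt_trans ax)// ltrDl.
  - apply: cp.
  apply: (DeriveDef d1); rewrite -derive1E; exact: d2.
exists P; split=> // c d ac cd; apply: ointegral_FTC => // x /andP[cx _].
by apply: dP; exact: le_trans cx.
Qed.

Lemma ointegralD p q a b : a < b -> continuous p -> continuous q ->
  J (fun x => p x + q x) a b = J p a b + J q a b.
Proof.
move=> ab cp cq; have [P [dP ->//]] := @primitive_exists _ a cp.
have [Q [dQ ->//]] := @primitive_exists _ a cq.
have -> : P b - P a + (Q b - Q a) = (P + Q) b - (P + Q) a by rewrite !fctE; ring.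
apply: ointegral_FTC => //.
- by move=> x; apply: cvgD; [apply: cp|exact: cq].
- by move=> x /andP[ax _]; exact: (is_deriveD (dP x ax) (dQ x ax)).
Qed.

Lemma ointegralZ k p a b : a < b -> continuous p ->
  J (fun x => k * p x) a b = k * J p a b.
Proof.
move=> ab cp; have [P [dP ->//]] := @primitive_exists _ a cp.
rewrite mulrBr; apply: (@ointegral_FTC _ (k \*: P)) => //.
- by move=> x; apply: cvgMl_tmp; apply: cp.
- by move=> x /andP[ax _]; exact: (is_deriveZ k (dP x ax)).
Qed.

Lemma ointegral_chasles p a b c : a < b -> b < c -> continuous p ->
  J p a b + J p b c = J p a c.
Proof.
move=> ab bc cp; have [P [dP JP]] := @primitive_exists _ a cp.
rewrite JP// JP ?ltW// JP//; first by ring.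
exact: lt_trans bc.
Qed.

Lemma ointegral_cst k a b : a < b -> J (fun=> k) a b = k * (b - a).
Proof.
move=> ab; rewrite mulrBr; apply: (@ointegral_FTC _ (k \*: id)) => //.
  by move=> x; exact: cvg_cst.
move=> x _; rewrite -[X in is_derive _ _ _ X]mulr1.
exact: (is_deriveZ k (is_derive_id x 1)).
Qed.

Lemma ointegral_ge0 p a b : a < b -> continuous p ->
  (forall x, a <= x <= b -> 0 <= p x) -> 0 <= J p a b.
Proof.
move=> ab cp p0; apply: Rintegral_ge0 => x /=; rewrite in_itv/=; exact: p0.
Qed.

Lemma ointegral_le p q a b : a < b -> continuous p -> continuous q ->
  (forall x, a <= x <= b -> p x <= q x) -> J p a b <= J q a b.
Proof.
move=> ab cp cq pq; rewrite -subr_ge0 -[- J p a b]mulN1r -ointegralZ//.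
rewrite -ointegralD//; last by move=> x; apply: cvgMl_tmp; apply: cp.
apply: ointegral_ge0 => // [x|x /pq]; last by rewrite mulN1r subr_ge0.
by apply: cvgD; [exact: cq|apply: cvgMl_tmp; apply: cp].
Qed.

Lemma ointegral_norm_le M p a b : a < b -> continuous p ->
  (forall x, a <= x <= b -> `|p x| <= M) -> `|J p a b| <= M * (b - a).
Proof.
move=> ab cp pM; have cM : continuous (fun _ : R => M) by exact: cst_continuous.
have cNM : continuous (fun _ : R => - M) by exact: cst_continuous.
rewrite ler_norml -mulNr -!ointegral_cst//; apply/andP; split.
  by apply: ointegral_le => // x /pM; rewrite ler_norml => /andP[].
by apply: ointegral_le => // x /pM; rewrite ler_norml => /andP[].
Qed.

End interval_integral.

(** * Green's theorem on rectangles, by bisection *)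

Section green.
Context {R : realType}.
Implicit Types (G : R -> R -> R -> R -> R) (a b c d s t e L : R).
Local Notation J := ointegral.

Lemma small_halving e L : 0 < e -> exists n, L / 2 ^+ n < e.
Proof.
move=> e0; exists (Num.truncn (`|L| / e)).+1.
have h : `|L| / e < 2 ^+ (Num.truncn (`|L| / e)).+1.
  have h1 : `|L| / e < (Num.truncn (`|L| / e)).+1%:R.
    by apply: truncnS_gt.
  apply: (lt_le_trans h1); rewrite -natrX ler_nat; apply: ltnW; exact: ltn_expl.
rewrite ltr_pdivrMr ?exprn_gt0// (le_lt_trans (ler_norm L))//.
by rewrite mulrC -ltr_pdivrMr.
Qed.

(* Bisection: an additive function of rectangles that is locally negligible
   with respect to the area vanishes. *)
Lemma rectangle_additive_eq0 G s0 s1 t0 t1 : s0 < s1 -> t0 < t1 ->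
  (forall a b c t t', a < b -> b < c -> t < t' ->
     G a c t t' = G a b t t' + G b c t t') ->
  (forall a b c s s', a < b -> b < c -> s < s' ->
     G s s' a c = G s s' a b + G s s' b c) ->
  (forall s t, s0 <= s <= s1 -> t0 <= t <= t1 -> forall e, 0 < e ->
     exists2 de, 0 < de & forall a b c d,
     s0 <= a -> a <= s <= b -> b <= s1 -> t0 <= c -> c <= t <= d -> d <= t1 ->
     a < b -> c < d -> b - a < de -> d - c < de ->
     `|G a b c d| <= e * (b - a + (d - c)) ^+ 2) ->
  G s0 s1 t0 t1 = 0.
Proof.
move=> s01 t01 Gs Gt Gloc; apply: contrapT => /eqP; rewrite -normr_gt0 => G0.
pose L := s1 - s0; pose H := t1 - t0.
have L0 : 0 < L by rewrite subr_gt0.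
have H0 : 0 < H by rewrite subr_gt0.
pose w n : R := L / 2 ^+ n; pose h n : R := H / 2 ^+ n.
have w0 n : 0 < w n by rewrite divr_gt0 ?exprn_gt0.
have h0 n : 0 < h n by rewrite divr_gt0 ?exprn_gt0.
have wS n : w n = w n.+1 + w n.+1.
  by rewrite /w exprS invfM; field; rewrite expf_neq0 ?pnatr_eq0.
have hS n : h n = h n.+1 + h n.+1.
  by rewrite /h exprS invfM; field; rewrite expf_neq0 ?pnatr_eq0.
pose Q n (p : R * R) := `|G p.1 (p.1 + w n) p.2 (p.2 + h n)|.
(* Passes to a quarter of the rectangle that carries at least a quarter of |G|. If the first three
   fail, additivity forces the fourth. *)
pose next n (p : R * R) :=
  let ok q := Q n p / 4 <= Q n.+1 q in
  if ok p then p else if ok (p.1 + w n.+1, p.2) then (p.1 + w n.+1, p.2)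
  else if ok (p.1, p.2 + h n.+1) then (p.1, p.2 + h n.+1)
  else (p.1 + w n.+1, p.2 + h n.+1).
have nextQ n p : Q n p / 4 <= Q n.+1 (next n p).
  rewrite /next; case: ifPn => // q1; case: ifPn => // q2; case: ifPn => // q3.
  have := w0 n.+1; have := h0 n.+1; case: p q1 q2 q3 => a c /=.
  rewrite -!ltNge /Q /= (wS n) (hS n) => q1 q2 q3 h0' w0'.
  have E : G a (a + (w n.+1 + w n.+1)) c (c + (h n.+1 + h n.+1)) =
      G a (a + w n.+1) c (c + h n.+1)
    + G (a + w n.+1) (a + w n.+1 + w n.+1) c (c + h n.+1)
    + G a (a + w n.+1) (c + h n.+1) (c + h n.+1 + h n.+1)
    + G (a + w n.+1) (a + w n.+1 + w n.+1) (c + h n.+1) (c + h n.+1 + h n.+1).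
    rewrite !addrA (Gs a (a + w n.+1)) ?ltrDl//; last by lra.
    rewrite (Gt c (c + h n.+1) _ a) ?ltrDl//.
    by rewrite (Gt c (c + h n.+1) _ (a + w n.+1)) ?ltrDl//; ring.
  set A := `|G a (a + (_ + _)) _ _| in q1 q2 q3 *.
  have : A <= `|G a (a + w n.+1) c (c + h n.+1)|
    + `|G (a + w n.+1) (a + w n.+1 + w n.+1) c (c + h n.+1)|
    + `|G a (a + w n.+1) (c + h n.+1) (c + h n.+1 + h n.+1)|
    + `|G (a + w n.+1) (a + w n.+1 + w n.+1) (c + h n.+1) (c + h n.+1 + h n.+1)|.
    rewrite /A E; apply: le_trans (ler_normD _ _) _; rewrite lerD2r.
    by apply: le_trans (ler_normD _ _) _; rewrite lerD2r ler_normD.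
  by lra.
have next1 n p : p.1 <= (next n p).1 /\ (next n p).1 + w n.+1 <= p.1 + w n.
  have := w0 n.+1; rewrite (wS n) /next; do ![case: ifP => _] => /= ?; split; lra.
have next2 n p : p.2 <= (next n p).2 /\ (next n p).2 + h n.+1 <= p.2 + h n.
  have := h0 n.+1; rewrite (hS n) /next; do ![case: ifP => _] => /= ?; split; lra.
pose q := fix q n := if n is m.+1 then next m (q m) else (s0, t0).
have q0Q n : Q 0%N (s0, t0) / 4 ^+ n <= Q n (q n).
  elim: n => [|n IH]; first by rewrite expr0 divr1.
  apply: le_trans (nextQ _ _); rewrite exprSr invfM mulrA.
  by rewrite ler_pM2r// invr_gt0.
have inc1 n k : (q n).1 <= (q (n + k)%N).1 /\
    (q (n + k)%N).1 + w (n + k)%N <= (q n).1 + w n.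
  elim: k => [|k [IH1 IH2]]; first by rewrite addn0.
  rewrite addnS; have [a1 a2] := next1 (n + k)%N (q (n + k)%N).
  by split; [exact: le_trans IH1 a1|exact: le_trans a2 IH2].
have inc2 n k : (q n).2 <= (q (n + k)%N).2 /\
    (q (n + k)%N).2 + h (n + k)%N <= (q n).2 + h n.
  elim: k => [|k [IH1 IH2]]; first by rewrite addn0.
  rewrite addnS; have [a1 a2] := next2 (n + k)%N (q (n + k)%N).
  by split; [exact: le_trans IH1 a1|exact: le_trans a2 IH2].
(* No lower corner passes the upper side of any rectangle of the sequence, so the suprema of the
   lower corners give a point common to all of them. *)
have cross1 n m : (q m).1 <= (q n).1 + w n.
  have [_ a] := inc1 n m; have [b _] := inc1 m n; rewrite addnC in b.
  by have := w0 (n + m)%N; lra.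
have cross2 n m : (q m).2 <= (q n).2 + h n.
  have [_ a] := inc2 n m; have [b _] := inc2 m n; rewrite addnC in b.
  by have := h0 (n + m)%N; lra.
pose S := sup (range (fun n => (q n).1)); pose T := sup (range (fun n => (q n).2)).
have HS n : (q n).1 <= S <= (q n).1 + w n.
  apply/andP; split.
    apply: ub_le_sup; last by exists n.
    by exists ((q 0%N).1 + w 0%N) => _ [m _ <-].
  apply: ge_sup; first by exists (q 0%N).1, 0%N.
  by move=> _ [m _ <-].
have HT n : (q n).2 <= T <= (q n).2 + h n.
  apply/andP; split.
    apply: ub_le_sup; last by exists n.
    by exists ((q 0%N).2 + h 0%N) => _ [m _ <-].
  apply: ge_sup; first by exists (q 0%N).2, 0%N.
  by move=> _ [m _ <-].
have w0E : s0 + w 0%N = s1 by rewrite /w expr0 divr1 /L addrC subrK.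
have h0E : t0 + h 0%N = t1 by rewrite /h expr0 divr1 /H addrC subrK.
have Q0E : Q 0%N (s0, t0) = `|G s0 s1 t0 t1| by rewrite /Q /= w0E h0E.
have LH0 : 0 < (L + H) ^+ 2 by rewrite exprn_gt0// addr_gt0.
(* The lower bound on |G| and the square of the half-perimeter both shrink by 4 at each step; with
   this [e] the local estimate would give |G| <= |G| / 2. *)
pose e := `|G s0 s1 t0 t1| / 2 / (L + H) ^+ 2.
have e0 : 0 < e by rewrite !divr_gt0.
have HS0 := HS 0%N; have HT0 := HT 0%N; rewrite /= w0E h0E in HS0 HT0.
have [de de0 Hde] := Gloc S T HS0 HT0 e e0.
have [n1 Hn1] := @small_halving de L de0; have [n2 Hn2] := @small_halving de H de0.
pose n := (n1 + n2)%N.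
have wn : w n < de.
  apply: le_lt_trans Hn1; rewrite ler_pM2l// lef_pV2 ?posrE ?exprn_gt0//.
  by rewrite ler_eXn2l ?leq_addr// ltr1n.
have hn : h n < de.
  apply: le_lt_trans Hn2; rewrite ler_pM2l// lef_pV2 ?posrE ?exprn_gt0//.
  by rewrite ler_eXn2l ?leq_addl// ltr1n.
have [i1 i2] := inc1 0%N n; have [i3 i4] := inc2 0%N n.
rewrite /= add0n w0E in i1 i2; rewrite /= add0n h0E in i3 i4.
have := Hde (q n).1 ((q n).1 + w n) (q n).2 ((q n).2 + h n) i1 (HS n) i2 i3 (HT n) i4.
rewrite !ltrDl => /(_ (w0 n) (h0 n)).
have -> : (q n).1 + w n - (q n).1 = w n by ring.
have -> : (q n).2 + h n - (q n).2 = h n by ring.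
move=> /(_ wn hn) big; have := le_trans (q0Q n) big; rewrite Q0E.
have -> : (w n + h n) ^+ 2 = (L + H) ^+ 2 / 4 ^+ n.
  rewrite /w /h -mulrDl exprMn exprVn -exprM mulnC exprM.
  by congr (_ / (_ ^+ n)); rewrite expr2 -natrM.
rewrite mulrA ler_pM2r ?invr_gt0 ?exprn_gt0// /e divfK ?gt_eqF//.
by lra.
Qed.

Lemma continuousB_fun (p q : R -> R) : continuous p -> continuous q ->
  continuous (fun x => p x - q x).
Proof. by move=> cp cq x; apply: cvgB; [exact: cp|exact: cq]. Qed.

Lemma ointegralB (p q : R -> R) a b : a < b -> continuous p -> continuous q ->
  J (fun x => p x - q x) a b = J p a b - J q a b.
Proof.
move=> ab cp cq; have e : (fun x => p x - q x) = (fun x => p x + -1 * q x).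
  by apply/funext => x; rewrite mulN1r.
rewrite e ointegralD ?ointegralZ ?mulN1r// => x.
by apply: cvgMl_tmp; exact: cq.
Qed.

Lemma ointegral_near_cst (p : R -> R) (k M : R) a b : a < b -> continuous p ->
  (forall x, a <= x <= b -> `|p x - k| <= M) ->
  `|J p a b - k * (b - a)| <= M * (b - a).
Proof.
move=> ab cp pk; have ck : continuous (fun _ : R => k) by exact: cst_continuous.
rewrite -(ointegral_cst k ab) -ointegralB//.
by apply: ointegral_norm_le => //; exact: continuousB_fun.
Qed.

Lemma itv_dist a b x s : a <= x <= b -> a <= s <= b -> `|x - s| <= b - a.
Proof.
by move=> /andP[? ?] /andP[? ?]; rewrite ler_norml; apply/andP; split; lra.
Qed.

Lemma dist_subr (x x' y y' k e : R) : `|x - y| <= e / 2 -> `|x' - y'| <= e / 2 ->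
  k = y - y' -> `|x - x' - k| <= e.
Proof.
move=> h h' ->; rewrite (_ : x - x' - _ = (x - y) - (x' - y')); last by ring.
by apply: le_trans (ler_normB _ _) _; rewrite (splitr e) lerD.
Qed.

(* Green's theorem for a field (v, u) with u_s = v_t, under pointwise
   differentiability only (Goursat's argument). *)
Lemma goursat (u v : R -> R -> R) s0 s1 t0 t1 : s0 < s1 -> t0 < t1 ->
  (forall s, continuous (u s)) -> (forall t, continuous (v^~ t)) ->
  (forall s t, s0 <= s <= s1 -> t0 <= t <= t1 ->
    exists k l m, forall e, 0 < e -> exists2 de, 0 < de & forall s' t',
    s0 <= s' <= s1 -> t0 <= t' <= t1 -> `|s' - s| < de -> `|t' - t| < de ->
    `|u s' t' - (u s t + k * (s' - s) + l * (t' - t))| <= e * (`|s' - s| + `|t' - t|) /\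
    `|v s' t' - (v s t + m * (s' - s) + k * (t' - t))| <= e * (`|s' - s| + `|t' - t|)) ->
  J (fun t => u s1 t - u s0 t) t0 t1 = J (fun s => v s t1 - v s t0) s0 s1.
Proof.
move=> s01 t01 cu cv loc.
(* The circulation of the field [(v, u)] around the rectangle. *)
pose G a b c d := J (fun t => u b t - u a t) c d - J (fun s => v s d - v s c) a b.
suff : G s0 s1 t0 t1 = 0 by move/eqP; rewrite subr_eq0 => /eqP.
apply: rectangle_additive_eq0 => //.
- move=> a b c t t' ab bc tt'; rewrite /G.
  rewrite -(@ointegral_chasles _ _ a b c)//; last exact: continuousB_fun.
  by rewrite !ointegralB//; ring.
- move=> a b c t t' ab bc tt'; rewrite /G.
  rewrite -(@ointegral_chasles _ _ a b c)//; last exact: continuousB_fun.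
  by rewrite (@ointegralB (v^~ c))// (@ointegralB (v^~ b))// (@ointegralB (v^~ c))//; ring.
move=> s t Hs Ht e e0; have [k [l [m H]]] := loc s t Hs Ht.
have [|de de0 {}H] := H (e / 2); first by rewrite divr_gt0.
exists de => // a b c d sa /andP[as' sb] bs tc /andP[ct td] dt ab cd dab dcd.
pose D := b - a + (d - c).
have D0 : 0 <= D by rewrite addr_ge0// subr_ge0 ltW.
have near x y : a <= x <= b -> c <= y <= d ->
    `|u x y - (u s t + k * (x - s) + l * (y - t))| <= e * D / 2 /\
    `|v x y - (v s t + m * (x - s) + k * (y - t))| <= e * D / 2.
  move=> /andP[ax xb] /andP[cy yd].
  have nx : `|x - s| <= b - a by apply: itv_dist; apply/andP.
  have ny : `|y - t| <= d - c by apply: itv_dist; apply/andP.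
  have [|||| h1 h2] := H x y.
  - by rewrite (le_trans sa ax) (le_trans xb bs).
  - by rewrite (le_trans tc cy) (le_trans yd dt).
  - exact: le_lt_trans dab.
  - exact: le_lt_trans dcd.
  have h3 : e / 2 * (`|x - s| + `|y - t|) <= e * D / 2.
    by rewrite [e * D / 2]mulrAC ler_pM2l ?divr_gt0// lerD.
  by split; [exact: le_trans h1 h3|exact: le_trans h2 h3].
have aI : a <= a <= b by rewrite lexx ltW.
have bI : a <= b <= b by rewrite lexx ltW.
have cI : c <= c <= d by rewrite lexx ltW.
have dI : c <= d <= d by rewrite lexx ltW.
(* The affine parts of [u] and [v] both contribute [k] times the area, since [u_s] and [v_t] are the
   same [k]. They cancel in [G] and only the remainders are left. *)
have Ju : `|J (fun y => u b y - u a y) c d - k * (b - a) * (d - c)| <= e * D * (d - c).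
  apply: ointegral_near_cst => //; first exact: continuousB_fun.
  move=> y yI; have [h1 _] := near a y aI yI; have [h2 _] := near b y bI yI.
  by apply: dist_subr h2 h1 _; ring.
have Jv : `|J (fun x => v x d - v x c) a b - k * (d - c) * (b - a)| <= e * D * (b - a).
  apply: ointegral_near_cst => //; first exact: continuousB_fun.
  move=> x xI; have [_ h1] := near x c xI cI; have [_ h2] := near x d xI dI.
  by apply: dist_subr h2 h1 _; ring.
rewrite -/D /G; move: Ju Jv.
set j1 := J _ _ _; set j2 := J _ _ _ => Ju Jv.
have -> : j1 - j2 = (j1 - k * (b - a) * (d - c)) - (j2 - k * (d - c) * (b - a)) by ring.
apply: le_trans (ler_normB _ _) _; apply: le_trans (lerD Ju Jv) _.
by rewrite -mulrDr expr2 mulrA [d - c + _]addrC.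
Qed.

End green.

(** * The mean value property *)

Lemma is_derive_dist (K : numFieldType) (f : K -> K) (x d : K) :
  is_derive x 1 f d -> forall e : K, 0 < e -> exists2 de, 0 < de &
  forall y, `|y - x| < de -> `|f y - f x - d * (y - x)| <= e * `|y - x|.
Proof.
move=> [df dE] e e0.
move: df; rewrite /derivable => /cvg_ex[l dl].
have lE : l = d by rewrite -dE /derive; apply/esym/cvg_lim.
move: dl; rewrite lE => /cvgrPdist_le/(_ e e0).
rewrite /dnbhs /within/= => /nbhs_ballP[de de0 Hde]; exists de => // y yx.
have [->|yx0] := eqVneq y x; first by rewrite !subrr mulr0 subrr normr0 mulr0.
have h0 : y - x != 0 by rewrite subr_eq0.
have := Hde (y - x); rewrite -ball_normE /= sub0r normrN => /(_ yx h0).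
have -> : (y - x)%:A + x = y by rewrite [_%:A]mulr1 subrK.
move=> H.
have -> : f y - f x - d * (y - x) = - (d - (y - x)^-1 * (f y - f x)) * (y - x).
  by rewrite mulNr mulrBl mulrAC mulVf// mul1r opprB.
by rewrite normrM normrN ler_wpM2r.
Qed.

Notation normc := ComplexField.Normc.normc.
Local Open Scope complex_scope.

(** * The modulus as a real number *)

Section complex_modulus.
Context {R : realType}.
Implicit Types (z w d : R[i]) (e de : R).

Lemma normC z : `|z| = (normc z)%:C.
Proof. by []. Qed.

Lemma normc_ge0 z : 0 <= normc z.
Proof. by rewrite -ler0c -normC normr_ge0. Qed.

Lemma normcR (x : R) : normc x%:C = `|x|.
Proof. by rewrite /= expr0n addr0 sqrtr_sqr. Qed.

Lemma normc_eq0 z : (normc z == 0) = (z == 0).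
Proof.
by apply/eqP/eqP => [/ComplexField.Normc.eq0_normc//|->]; rewrite ComplexField.Normc.normc0.
Qed.

Lemma normc_gt0 z : (0 < normc z) = (z != 0).
Proof. by rewrite lt_neqAle normc_ge0 andbT eq_sym normc_eq0. Qed.

Lemma ler_normcD z w : normc (z + w) <= normc z + normc w.
Proof. by rewrite -lecR rmorphD /= -!normC ler_normD. Qed.

Lemma normcM z w : normc (z * w) = normc z * normc w.
Proof. exact: ComplexField.Normc.normcM. Qed.

Lemma normcN z : normc (- z) = normc z.
Proof. by apply: complexI; rewrite -!normC normrN. Qed.

Lemma normcV z : normc z^-1 = (normc z)^-1.
Proof. exact: ComplexField.Normc.normcV. Qed.

Lemma ler_normcB z w : normc (z - w) <= normc z + normc w.
Proof. by rewrite -(normcN w) ler_normcD. Qed.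

Lemma normcBC z w : normc (z - w) = normc (w - z).
Proof. by rewrite -normcN opprB. Qed.

Lemma normc_ge_Re z : `|complex.Re z| <= normc z.
Proof. by rewrite -lecR -normC normc_ge_Re. Qed.

Lemma normc_ge_Im z : `|complex.Im z| <= normc z.
Proof.
rewrite -sqrtr_sqr; case: z => a b /=.
by rewrite ler_wsqrtr// lerDr sqr_ge0.
Qed.

Lemma normc_le_ReIm z : normc z <= `|complex.Re z| + `|complex.Im z|.
Proof.
case: z => a b /=; rewrite -(@ger0_norm _ (`|a| + `|b|)) ?addr_ge0// -sqrtr_sqr.
rewrite ler_wsqrtr// sqrrD !real_normK ?num_real// -addrA [_ *+ 2 + _]addrC addrA.
by rewrite lerDl mulrn_wge0// mulr_ge0.
Qed.

Lemma is_derive_normc (q : R[i] -> R[i]) z d : is_derive z 1 q d ->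
  forall e, 0 < e -> exists2 de, 0 < de & forall w, normc (w - z) < de ->
  normc (q w - q z - d * (w - z)) <= e * normc (w - z).
Proof.
move=> dq e e0; have ec : 0 < e%:C by rewrite ltcR.
have [de de0 H] := is_derive_dist dq ec.
move: de0 H; rewrite ltcE /= => /andP[/eqP dei0 der0] H.
exists (complex.Re de) => // w wz; rewrite -lecR rmorphM/= -!normC; apply: H.
by rewrite ltcE /= dei0 eqxx.
Qed.

Lemma derivable_continuous_normc (q : R[i] -> R[i]) z : derivable q z 1 ->
  forall e, 0 < e -> exists2 de, 0 < de & forall w, normc (w - z) < de ->
  normc (q w - q z) <= e.
Proof.
move=> /derivableP dq e e0; set d := 'D_1 q z in dq.
have [de de0 H] := is_derive_normc dq ltr01.
have k0 : 0 < 1 + normc d by rewrite ltr_pwDl// normc_ge0.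
exists (Num.min de (e / (1 + normc d))); first by rewrite lt_min de0 divr_gt0.
move=> w; rewrite lt_min => /andP[w1 w2].
have -> : q w - q z = (q w - q z - d * (w - z)) + d * (w - z) by ring.
apply: le_trans (ler_normcD _ _) _; apply: le_trans (lerD (H w w1) (lexx _)) _.
by rewrite normcM -mulrDl mulrC -ler_pdivlMr// ltW.
Qed.

End complex_modulus.

(** * First-order expansion of [e^(s + i t)] *)

Section polar.
Context {R : realType}.
Implicit Types (s t x y e de : R) (z w : R[i]).

Definition cis t : R[i] := cos t +i* sin t.

Lemma normc_cis t : normc (cis t) = 1.
Proof. by rewrite /= cos2Dsin2 sqrtr1. Qed.

Lemma cis_neq0 t : cis t != 0.
Proof. by rewrite -normc_gt0 normc_cis. Qed.

Lemma cisD t y : cis (t + y) = cis t * cis y.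
Proof. by rewrite /cis cosD sinD; apply/eqP; rewrite eq_complex /= eqxx addrC eqxx. Qed.

Lemma cis2pi : cis (pi *+ 2) = 1.
Proof. by rewrite /cis cos2pi sin2pi. Qed.

Lemma cis0 : cis 0 = 1.
Proof. by rewrite /cis cos0 sin0. Qed.

Definition polar s t : R[i] := (expR s)%:C * cis t.

Lemma normc_polar s t : normc (polar s t) = expR s.
Proof. by rewrite normcM normc_cis mulr1 normcR gtr0_norm// expR_gt0. Qed.

Lemma polarD s t x y : polar (s + x) (t + y) = polar s t * polar x y.
Proof. by rewrite /polar expRD cisD rmorphM/=; ring. Qed.

Lemma polar_neq0 s t : polar s t != 0.
Proof. by rewrite -normc_gt0 normc_polar expR_gt0. Qed.

Let expR1 e : 0 < e -> exists2 de, 0 < de & forall x, `|x| < de ->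
  `|expR x - 1 - x| <= e * `|x|.
Proof.
move=> e0; have d1 : is_derive (0 : R) 1 expR 1.
  by rewrite -[X in is_derive _ _ _ X]expR0; exact: is_derive_expR.
have [de de0 H] := is_derive_dist d1 e0; exists de => // x xde.
by have := H x; rewrite subr0 expR0 mul1r; exact.
Qed.

Let cos1 e : 0 < e -> exists2 de, 0 < de & forall x, `|x| < de ->
  `|cos x - 1| <= e * `|x|.
Proof.
move=> e0; have d1 : is_derive (0 : R) 1 cos 0.
  by have := is_derive_cos (0 : R); rewrite sin0 oppr0.
have [de de0 H] := is_derive_dist d1 e0; exists de => // x xde.
by have := H x; rewrite subr0 cos0 mul0r subr0; exact.
Qed.

Let sin1 e : 0 < e -> exists2 de, 0 < de & forall x, `|x| < de ->
  `|sin x - x| <= e * `|x|.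
Proof.
move=> e0; have d1 : is_derive (0 : R) 1 sin 1.
  by have := is_derive_sin (0 : R); rewrite cos0.
have [de de0 H] := is_derive_dist d1 e0; exists de => // x xde.
by have := H x; rewrite subr0 sin0 mul1r subr0; exact.
Qed.

Lemma polar_diff0 e : 0 < e -> exists2 de, 0 < de & forall x y,
  `|x| < de -> `|y| < de ->
  normc (polar x y - 1 - (x +i* y)) <= e * (`|x| + `|y|).
Proof.
(* The three terms below add up to at most [8 * k] times |x| + |y|; [k <= 1] gives |1 + x + a| <=
   3. *)
move=> e0; pose k := Num.min e 1 / 12.
have k0 : 0 < k by rewrite divr_gt0// lt_min e0 ltr01.
have k1 : k <= 1 by rewrite /k ler_pdivrMr// ge_min; apply/orP; right; lra.
have ke : 12 * k <= e by rewrite /k mulrC divfK// ge_min lexx.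
have [d1 d10 H1] := expR1 k0; have [d2 d20 H2] := cos1 k0; have [d3 d30 H3] := sin1 k0.
exists (Num.min (Num.min d1 d2) (Num.min d3 k)); first by rewrite !lt_min d10 d20 d30.
move=> x y; rewrite !lt_min => /andP[/andP[xd1 _] /andP[_ xk]].
move=> /andP[/andP[_ yd2] /andP[yd3 yk]].
have {}H1 := H1 x xd1; have {}H2 := H2 y yd2; have {}H3 := H3 y yd3.
set a := expR x - 1 - x in H1.
have EE : polar x y - 1 - (x +i* y) =
   a%:C + (1 + x + a)%:C * ((cos y - 1) +i* (sin y - y)) + (x + a)%:C * (0 +i* y).
  by apply/eqP; rewrite eq_complex /= /a; apply/andP; split; apply/eqP; ring.
rewrite EE.
have n1 : normc ((cos y - 1) +i* (sin y - y)) <= 2 * k * `|y|.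
  apply: le_trans (normc_le_ReIm _) _; rewrite /= -mulrA mulr_natl mulr2n.
  exact: lerD.
have n2 : normc (0 +i* y) <= `|y|.
  by apply: le_trans (normc_le_ReIm _) _; rewrite /= normr0 add0r.
have xa : `|x + a| <= 2 * k.
  apply: le_trans (ler_normD _ _) _.
  have : k * `|x| <= k * 1 by rewrite ler_pM2l// (le_trans (ltW xk)).
  by move: H1 xk; lra.
have xa1 : `|1 + x + a| <= 3.
  rewrite -addrA; apply: le_trans (ler_normD _ _) _; rewrite normr1.
  by move: xa k1; lra.
apply: le_trans (ler_normcD _ _) _; apply: le_trans (lerD (ler_normcD _ _) (lexx _)) _.
rewrite !normcM !normcR.
have m1 : `|1 + x + a| * normc ((cos y - 1) +i* (sin y - y)) <= 3 * (2 * k * `|y|).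
  by apply: ler_pM => //; exact: normc_ge0.
have m2 : `|x + a| * normc (0 +i* y) <= 2 * k * `|y|.
  by apply: ler_pM => //; exact: normc_ge0.
have m3 : 12 * k * (`|x| + `|y|) <= e * (`|x| + `|y|) by rewrite ler_wpM2r// addr_ge0.
apply: le_trans m3; move: H1 m1 m2 (mulr_ge0 (ltW k0) (normr_ge0 x)) (mulr_ge0 (ltW k0) (normr_ge0 y)).
lra.
Qed.

Lemma polar_diff s t e : 0 < e -> exists2 de, 0 < de & forall s' t',
  `|s' - s| < de -> `|t' - t| < de ->
  normc (polar s' t' - polar s t - polar s t * ((s' - s) +i* (t' - t)))
    <= e * (`|s' - s| + `|t' - t|).
Proof.
move=> e0; have [de de0 H] := @polar_diff0 (e / expR s) (divr_gt0 e0 (expR_gt0 s)).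
exists de => // s' t' s1 t1; have := H _ _ s1 t1.
have -> : polar s' t' = polar s t * polar (s' - s) (t' - t).
  by rewrite -polarD; congr polar; ring.
set P := polar (s' - s) (t' - t).
have -> : polar s t * P - polar s t - polar s t * ((s' - s) +i* (t' - t)) =
  polar s t * (P - 1 - ((s' - s) +i* (t' - t))) by ring.
by rewrite normcM normc_polar mulrAC ler_pdivlMr ?expR_gt0// mulrC.
Qed.

End polar.

(** * Circular means in polar coordinates *)

Section mean_value.
Context {R : realType}.
Implicit Types (s t x y e de r rad : R) (z w A : R[i]) (q : R[i] -> R[i]).

Lemma polar_continuous s t e : 0 < e -> exists2 de, 0 < de & forall s' t',
  `|s' - s| < de -> `|t' - t| < de -> normc (polar s' t' - polar s t) < e.
Proof.
move=> e0; have [de de0 H] := polar_diff s t ltr01.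
have k0 : 0 < 2 * (1 + expR s) by rewrite mulr_gt0// addr_gt0// expR_gt0.
exists (Num.min de (e / (2 * (1 + expR s)))); first by rewrite lt_min de0 divr_gt0.
move=> s' t'; rewrite !lt_min => /andP[s1 s2] /andP[t1 t2].
have {}H := H _ _ s1 t1; rewrite mul1r in H.
set D := (s' - s) +i* (t' - t) in H.
have -> : polar s' t' - polar s t = (polar s' t' - polar s t - polar s t * D) + polar s t * D.
  by ring.
apply: le_lt_trans (ler_normcD _ _) _; rewrite normcM normc_polar.
have D1 : normc D <= `|s' - s| + `|t' - t| by exact: normc_le_ReIm.
apply: (@le_lt_trans _ _ ((1 + expR s) * (`|s' - s| + `|t' - t|))).
  by rewrite mulrDl mul1r lerD// ler_pM2l// expR_gt0.
rewrite ltr_pdivlMr// in s2; rewrite ltr_pdivlMr// in t2; lra.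
Qed.

Lemma continuous_comp_normc q (g : R -> R[i]) :
  (forall t e, 0 < e -> exists2 de, 0 < de & forall t', `|t' - t| < de ->
     normc (g t' - g t) < e) ->
  (forall t, derivable q (g t) 1) ->
  continuous (fun t => complex.Re (q (g t))) /\
  continuous (fun t => complex.Im (q (g t))).
Proof.
move=> cg dq.
have key t e : 0 < e -> \forall t' \near t, normc (q (g t') - q (g t)) <= e.
  move=> e0; have [d1 d10 H1] := derivable_continuous_normc (dq t) e0.
  have [d2 d20 H2] := cg t d1 d10.
  apply/nbhs_ballP; exists d2 => // t'; rewrite -ball_normE /= distrC => tt'.
  by apply: H1; exact: H2.
split=> t; apply/cvgrPdist_le => e /(key t); apply: filterS => t' Ht'.
  rewrite distrC -raddfB; apply: le_trans (normc_ge_Re _) Ht'.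
rewrite distrC -raddfB; apply: le_trans (normc_ge_Im _) Ht'.
Qed.

Lemma minr_dist s s' x : `|Num.min s' x - Num.min s x| <= `|s' - s|.
Proof.
case: (leP s' x) => h'; case: (leP s x) => h //.
- by rewrite !ler0_norm; lra.
- by rewrite !ger0_norm; lra.
- by rewrite subrr normr0.
Qed.

(* In the coordinates [polar s t = e^(s + i t)], the vertical sides of a rectangle
   of height [2 pi] contribute the circular means, which are thus independent of
   the radius. The value of [q] at [0] plays no role. *)
Lemma mean_value_punctured q A r rad : 0 < r -> r < rad ->
  (forall z, z != 0 -> normc z < rad -> derivable q z 1) ->
  (forall e, 0 < e -> exists2 de, 0 < de & forall z, z != 0 -> normc z < de ->
     normc (q z - A) <= e) ->
  ointegral (fun t => complex.Re (q (r%:C * cis t))) 0 (pi *+ 2)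
  = complex.Re A * (pi *+ 2).
Proof.
move=> r0 rr dq cq; pose T : R := pi *+ 2.
have T0 : 0 < T by rewrite mulrn_wgt0// pi_gt0.
pose S := ln r; have ES : expR S = r by rewrite lnK.
(* Clamping [s] at [S] keeps the radius at most [r], while [h] is continuous on the whole line in
   each variable, as [goursat] requires. *)
pose h s t := q (polar (Num.min s S) t).
have hd s t : derivable q (polar (Num.min s S) t) 1.
  apply: dq; first exact: polar_neq0.
  by rewrite normc_polar (le_lt_trans _ rr)// -ES ler_expR ge_min lexx orbT.
have minS s s' : `|Num.min s' S - Num.min s S| <= `|s' - s|.
  exact: minr_dist.
have cu s : continuous (fun t => complex.Re (h s t)).
  apply: (continuous_comp_normc _ (hd s)).1 => t e e0.
  have [de de0 H] := polar_continuous (Num.min s S) t e0.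
  by exists de => // t' tt'; apply: H => //; rewrite subrr normr0.
have cv t : continuous (fun s => complex.Im (h s t)).
  apply: (@continuous_comp_normc q (fun s => polar (Num.min s S) t) _ _).2 => // s e e0.
  have [de de0 H] := polar_continuous (Num.min s S) t e0.
  exists de => // s' ss'; apply: H => //; last by rewrite subrr normr0.
  exact: le_lt_trans ss'.
have indep s : s < S -> ointegral (fun t => complex.Re (h S t)) 0 T
    = ointegral (fun t => complex.Re (h s t)) 0 T.
  move=> sS; apply/eqP; rewrite -subr_eq0 -ointegralB//; apply/eqP.
  rewrite (@goursat _ (fun s t => complex.Re (h s t)) (fun s t => complex.Im (h s t)))//.
    (* The horizontal sides cancel, because [polar] has period [2 pi] in the angle. *)
    rewrite (_ : (fun _ => _ - _) = fun=> 0).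
      by rewrite ointegral_cst// mul0r.
    apply/funext => x; rewrite /h /polar /T.
    by rewrite cis2pi cis0 subrr.
  move=> a b /andP[_ aS] _; have := hd a b; rewrite min_l// => /derivableP.
  set d := 'D_1 q _ => dqab; pose D := d * polar a b.
  (* The Cauchy-Riemann equations: [D] is the derivative of [q (e^(s + i t))] with respect to
     [s + i t]. *)
  exists (complex.Re D), (- complex.Im D), (complex.Im D) => e e0.
  pose M := expR a + 1; have M0 : 0 < M by rewrite addr_gt0// expR_gt0.
  have [e1 e10 H1] := is_derive_normc dqab (divr_gt0 e0 (mulr_gt0 (ltr0n _ 2) M0)).
  have [e2 e20 H2] := polar_continuous a b e10.
  have nd0 : 0 < 2 * (1 + normc d) by rewrite mulr_gt0// ltr_pwDl// normc_ge0.
  have [e3 e30 H3] := polar_diff a b (divr_gt0 e0 nd0).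
  have [e4 e40 H4] := polar_diff a b ltr01.
  exists (Num.min e2 (Num.min e3 e4)); first by rewrite !lt_min e20 e30 e40.
  move=> a' b' /andP[_ aS'] _; rewrite !lt_min => /and3P[a2 a3 a4] /and3P[b2 b3 b4].
  have {}H2 := H2 a' b' a2 b2; have {}H3 := H3 a' b' a3 b3; have {}H4 := H4 a' b' a4 b4.
  have {}H1 := H1 _ H2; rewrite mul1r in H4.
  set X := (a' - a) +i* (b' - b) in H3 H4.
  set N := `|a' - a| + `|b' - b| in H3 H4 *.
  have N0 : 0 <= N by rewrite addr_ge0.
  have XN : normc X <= N by exact: normc_le_ReIm.
  have PN : normc (polar a' b' - polar a b) <= M * N.
    rewrite -[_ - _](subrK (polar a b * X)).
    apply: le_trans (ler_normcD _ _) _; rewrite normcM normc_polar /M mulrDl mul1r addrC.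
    by rewrite lerD// ler_pM2l// expR_gt0.
  have key : normc (h a' b' - h a b - D * X) <= e * N.
    rewrite /h !min_l//.
    have -> : q (polar a' b') - q (polar a b) - D * X =
      (q (polar a' b') - q (polar a b) - d * (polar a' b' - polar a b)) +
      d * (polar a' b' - polar a b - polar a b * X) by rewrite /D; ring.
    apply: le_trans (ler_normcD _ _) _; rewrite normcM.
    rewrite (splitr e) mulrDl; apply: lerD.
      apply: le_trans H1 _; apply: (@le_trans _ _ (e / (2 * M) * (M * N))).
        by rewrite ler_pM2l// divr_gt0// mulr_gt0.
      by rewrite le_eqVlt; apply/orP; left; apply/eqP; field; rewrite gt_eqF.
    apply: (@le_trans _ _ ((1 + normc d) * (e / (2 * (1 + normc d)) * N))).
      apply: ler_pM => //; rewrite ?normc_ge0//.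
      by rewrite lerDr.
    rewrite le_eqVlt; apply/orP; left; apply/eqP; field.
    by rewrite gt_eqF// ltr_pwDl// normc_ge0.
  have HD : D * X = (complex.Re D * (a' - a) + - complex.Im D * (b' - b)) +i*
      (complex.Im D * (a' - a) + complex.Re D * (b' - b)).
    rewrite /X; case: (D) => ? ? /=; apply/eqP; rewrite eq_complex /=.
    by rewrite mulNr eqxx addrC eqxx.
  split.
    apply: le_trans key; apply: le_trans (normc_ge_Re _).
    rewrite HD; move: (h a' b') (h a b) => [? ?] [? ?] /=.
    by rewrite le_eqVlt; apply/orP; left; apply/eqP; congr `|_|; ring.
  apply: le_trans key; apply: le_trans (normc_ge_Im _).
  rewrite HD; move: (h a' b') (h a b) => [? ?] [? ?] /=.
    by rewrite le_eqVlt; apply/orP; left; apply/eqP; congr `|_|; ring.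
have -> : (fun t => complex.Re (q (r%:C * cis t))) = (fun t => complex.Re (h S t)).
  by apply/funext => t; rewrite /h minxx /polar ES.
apply/eqP; rewrite -subr_eq0 -normr_le0; apply/ler_addgt0Pr => e e0; rewrite add0r.
have [de de0 H] := cq (e / T) (divr_gt0 e0 T0).
(* A circle so small that [q] is within [e / T] of [A] on it. *)
pose s := Num.min (S - 1) (ln de - 1).
have sS : s < S by rewrite gt_min gtrDl oppr_lt0 ltr01.
have sde : expR s < de.
  by rewrite -[X in _ < X]lnK// ltr_expR gt_min; apply/orP; right; rewrite gtrDl oppr_lt0.
have := @ointegral_near_cst _ (fun t => complex.Re (h s t)) (complex.Re A) (e / T) 0 T T0 (cu s).
rewrite -(indep s sS) subr0 divfK ?gt_eqF//; apply => t _.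
rewrite -raddfB; apply: le_trans (normc_ge_Re _) _; apply: H.
  exact: polar_neq0.
by rewrite normc_polar min_l// ltW.
Qed.

End mean_value.

(** * Estimates for holomorphic functions of one variable *)

Lemma is_derive_compC (K : numFieldType) (f g : K -> K) (z df dg : K) :
  is_derive z 1 g dg -> is_derive (g z) 1 f df ->
  is_derive z 1 (f \o g) (df * dg).
Proof.
move=> [dg1 dgE] [df1 dfE].
have dgz : differentiable g z by apply/derivable1_diffP.
have dfz : differentiable f (g z) by apply/derivable1_diffP.
have dc : differentiable (f \o g) z by exact: differentiable_comp.
apply: DeriveDef; first exact/derivable1_diffP.
rewrite deriveE// diff_comp//= -[X in 'd f _ X](@deriveE _ _ _ g)// dgE.
by rewrite diff1E// derive1E dfE mulrC.
Qed.

Section complex_derivatives.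
Context {R : realType}.
Implicit Types (z w d c u : R[i]) (e de r x B : R) (q F K : R[i] -> R[i]).

Lemma dist_is_derive (f : R -> R) (x d : R) :
  (forall e, 0 < e -> exists2 de, 0 < de & forall y, `|y - x| < de ->
    `|f y - f x - d * (y - x)| <= e * `|y - x|) -> is_derive x 1 f d.
Proof.
move=> H.
have cv : h^-1 *: (f (h *: (1 : R) + x) - f x) @[h --> 0^'] --> d.
  apply/cvgrPdist_le => e e0; have [de de0 {}H] := H e e0.
  rewrite /dnbhs /within/=; apply/nbhs_ballP; exists de => // h.
  rewrite -ball_normE /= sub0r normrN => hde h0.
  have := H (h + x); rewrite addrK => /(_ hde).
  rewrite [_%:A]mulr1 -ler_pdivrMr ?normr_gt0// -normfV -normrM.
  rewrite distrC; congr (_ <= _); congr `|_|; rewrite /GRing.scale/=.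
  by field.
apply: DeriveDef; first by apply/cvg_ex; exists d.
exact: cvg_lim cv.
Qed.

Lemma is_derive_slice q z w d x : is_derive (z + x%:C * w) 1 q d ->
  is_derive x 1 (fun x => complex.Re (q (z + x%:C * w))) (complex.Re (d * w)) /\
  is_derive x 1 (fun x => complex.Im (q (z + x%:C * w))) (complex.Im (d * w)).
Proof.
move=> dq.
have key e : 0 < e -> exists2 de, 0 < de & forall y, `|y - x| < de ->
    normc (q (z + y%:C * w) - q (z + x%:C * w) - (y - x)%:C * (d * w)) <= e * `|y - x|.
  move=> e0; have w0 : 0 < 1 + normc w by rewrite ltr_pwDl// normc_ge0.
  have [de de0 H] := is_derive_normc dq (divr_gt0 e0 w0).
  exists (de / (1 + normc w)); first exact: divr_gt0.
  move=> y yx; have E : z + y%:C * w - (z + x%:C * w) = (y - x)%:C * w.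
    by rewrite rmorphB/=; ring.
  have := H (z + y%:C * w); rewrite E normcM normcR => {}H.
  have -> : (y - x)%:C * (d * w) = d * ((y - x)%:C * w) by ring.
  apply: le_trans (H _) _.
    rewrite ltr_pdivlMr// in yx; apply: le_lt_trans yx.
    by rewrite ler_wpM2l// lerDr.
  rewrite mulrCA [leLHS]mulrC ler_wpM2r//.
  by rewrite mulrAC ler_pdivrMr// ler_pM2l// lerDr.
split; apply: dist_is_derive => e /key[de de0 H]; exists de => // y /H; apply: le_trans.
  apply: le_trans (normc_ge_Re _).
  move: (q (z + y%:C * w)) (q (z + x%:C * w)) (d * w) => [? ?] [? ?] [? ?] /=.
  by rewrite le_eqVlt; apply/orP; left; apply/eqP; congr `|_|; ring.
apply: le_trans (normc_ge_Im _).
move: (q (z + y%:C * w)) (q (z + x%:C * w)) (d * w) => [? ?] [? ?] [? ?] /=.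
by rewrite le_eqVlt; apply/orP; left; apply/eqP; congr `|_|; ring.
Qed.

(** The mean value property is stated for real parts; multiplying a function by a suitable [u] turns
    a modulus into a real part. *)
Lemma rotation z : exists2 u, normc u = 1 & u * z = (normc z)%:C.
Proof.
have [->|z0] := eqVneq z 0.
  by exists 1; rewrite ?mulr0 ?ComplexField.Normc.normc0// ComplexField.Normc.normc1.
have nz : normc z != 0 by rewrite normc_eq0.
exists ((normc z)%:C / z); last by rewrite divfK.
by rewrite normcM normcR normcV ger0_norm ?normc_ge0// mulfV.
Qed.

(** There is no mean value theorem with equality for complex values; it is applied to the real part
    of [F] after the rotation that makes the total increment real. *)
Lemma mean_value_le F (dF : R[i] -> R[i]) c w B :
  (forall x, 0 <= x <= 1 -> is_derive (c + x%:C * w) 1 F (dF (c + x%:C * w))) ->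
  (forall x, 0 <= x <= 1 -> normc (dF (c + x%:C * w)) <= B) ->
  normc (F (c + w) - F c) <= B * normc w.
Proof.
move=> dFP BP; have [u u1 uE] := rotation (F (c + w) - F c).
have udF x : 0 <= x <= 1 ->
    is_derive (c + x%:C * w) 1 (fun z => u * F z) (u * dF (c + x%:C * w)).
  by move=> /dFP H; exact: (is_deriveZ u H).
pose f x := complex.Re (u * F (c + x%:C * w)).
have fd x : 0 <= x <= 1 -> is_derive x 1 f (complex.Re (u * dF (c + x%:C * w) * w)).
  by move=> /udF/is_derive_slice[].
have cf : {within `[0, 1], continuous f}.
  apply: derivable_within_continuous => x; rewrite in_itv/= => /fd.
  by case.
have [x] := MVT ltr01 (fun x xI => fd x (subset_itv_oo_cc xI)) cf.
move=> /subset_itv_oo_cc; rewrite /= in_itv/= => xI; rewrite subr0 mulr1 => fE.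
have : normc (F (c + w) - F c) = f 1 - f 0.
  have -> : normc (F (c + w) - F c) = complex.Re (u * (F (c + w) - F c)) by rewrite uE.
  by rewrite /f mul1r mul0r addr0 mulrBr raddfB.
rewrite fE => ->; apply: le_trans (ler_norm _) _; apply: le_trans (normc_ge_Re _) _.
by rewrite !normcM u1 mul1r ler_wpM2r ?normc_ge0// BP.
Qed.

End complex_derivatives.

Lemma derivable_shiftl (K : numFieldType) (F : K -> K) (c z : K) :
  derivable F (c + z) 1 -> derivable (fun z => F (c + z)) z 1.
Proof.
move=> /derivableP dF; have dg : is_derive z 1 (fun z => c + z) 1.
  rewrite -[X in is_derive _ _ _ X]add0r.
  exact: (is_deriveD (is_derive_cst c z 1) (is_derive_id z 1)).
by case: (is_derive_compC dg dF).
Qed.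

Lemma derivable_slope (K : numFieldType) (F : K -> K) (c z : K) : z != 0 ->
  derivable F (c + z) 1 -> derivable (fun z => (F (c + z) - F c) / z) z 1.
Proof.
move=> z0 /derivable_shiftl dF; apply: derivableM.
  by apply: derivableB => //; exact: derivable_cst.
by apply: derivableV => //; exact: derivable_id.
Qed.

Lemma derivable_affM (K : numFieldType) (F : K -> K) (a b c z : K) :
  derivable F (c + z) 1 -> derivable (fun z => (a + b * z) * F (c + z)) z 1.
Proof.
move=> /derivable_shiftl dF; apply: derivableM; last exact: dF.
apply: derivableD; first exact: derivable_cst.
by apply: derivableM; [exact: derivable_cst|exact: derivable_id].
Qed.

Lemma is_derive_linear (K : numFieldType) (a z : K) : is_derive z 1 ( *%R a) a.
Proof.
rewrite -[X in is_derive _ _ _ X]mulr1.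
exact: (is_deriveZ a (is_derive_id z 1)).
Qed.

Lemma derivable_cstM (K : numFieldType) (F : K -> K) (a z : K) :
  derivable F z 1 -> derivable (fun z => a * F z) z 1.
Proof. by move=> dF; apply: derivableM => //; exact: derivable_cst. Qed.

Lemma derivable_moebius (K : numFieldType) (a b k z : K) : 1 + k * z != 0 ->
  derivable (fun z => (a + b * z) / (1 + k * z)) z 1.
Proof.
move=> kz; have aff (x y w : K) : derivable (fun z => x + y * z) w 1.
  apply: derivableD; first exact: derivable_cst.
  by apply: derivableM; [exact: derivable_cst|exact: derivable_id].
by apply: derivableM; [exact: aff|apply: derivableV; [exact: kz|exact: aff]].
Qed.

Lemma derivable_divX (K : numFieldType) (F : K -> K) (m : nat) (z : K) : z != 0 ->
  derivable F z 1 -> derivable (fun z => F z / z ^+ m) z 1.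
Proof.
move=> z0 dF; apply: derivableM; first exact: dF.
apply: derivableV; first by rewrite expf_neq0.
exact: exprn_derivable.
Qed.

(** * Cauchy estimates, Harnack's inequality and the identity theorem on discs *)

Section mean_value_consequences.
Context {R : realType}.
Implicit Types (z w d c u : R[i]) (e de r x B M rad : R) (q F K : R[i] -> R[i]).
Local Notation T := (@pi R *+ 2).
Local Notation circ r t := (r%:C * cis t).

Let T0 : 0 < T.
Proof. by rewrite mulrn_wgt0// pi_gt0. Qed.

Lemma circle_neq0 r t : 0 < r -> circ r t != 0.
Proof. by move=> r0; rewrite mulf_neq0// ?cis_neq0// -normc_gt0 normcR gtr0_norm. Qed.

Lemma normc_circle r t : 0 < r -> normc (circ r t) = r.
Proof. by move=> r0; rewrite normcM normc_cis mulr1 normcR gtr0_norm. Qed.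

Lemma continuous_circle q r : 0 < r -> (forall t, derivable q (circ r t) 1) ->
  continuous (fun t => complex.Re (q (circ r t))).
Proof.
move=> r0 dq; have E t : circ r t = polar (ln r) t by rewrite /polar lnK.
have -> : (fun t => complex.Re (q (circ r t))) = (fun t => complex.Re (q (polar (ln r) t))).
  by apply/funext => t; rewrite E.
apply: (@continuous_comp_normc _ q (polar (ln r)) _ _).1 => [t e e0|t]; last by rewrite -E.
have [de de0 H] := polar_continuous (ln r) t e0.
by exists de => // t' tt'; apply: H; rewrite // subrr normr0.
Qed.

Lemma mean_value q r rad : 0 < r -> r < rad ->
  (forall z, normc z < rad -> derivable q z 1) ->
  ointegral (fun t => complex.Re (q (circ r t))) 0 T = complex.Re (q 0) * T.
Proof.
move=> r0 rr dq; apply: (@mean_value_punctured _ q (q 0) r rad) => // [z _|e e0].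
  exact: dq.
have d0 : derivable q 0 1.
  by apply: dq; rewrite ComplexField.Normc.normc0 (lt_trans r0).
have [de de0 H] := derivable_continuous_normc d0 e0.
by exists de => // z _ zde; apply: H; rewrite subr0.
Qed.

(** Stands in for Cauchy's formula for [F'(c)]. The slope tends to [d] at the removable singularity
    [z = 0], where nothing is known about its differentiability; this is the use of the punctured
    form of the mean value property. *)
Lemma mean_value_slope F c d r rad u : 0 < r -> r < rad ->
  (forall z, normc (z - c) < rad -> derivable F z 1) -> is_derive c 1 F d ->
  ointegral (fun t => complex.Re (u * ((F (c + circ r t) - F c) / circ r t))) 0 T
  = complex.Re (u * d) * T.
Proof.
move=> r0 rr dF dc.
apply: (@mean_value_punctured _ (fun z => u * ((F (c + z) - F c) / z)) (u * d) r rad) => //.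
  move=> z z0 zr; apply: derivable_cstM; apply: derivable_slope => //.
  by apply: dF; rewrite addrC addKr.
move=> e e0; have k0 : 0 < 1 + normc u by rewrite ltr_pwDl// normc_ge0.
have [de de0 H] := is_derive_normc dc (divr_gt0 e0 k0).
exists de => // z z0 zde; have := H (c + z).
rewrite (addrC c z) addrK => /(_ zde); rewrite (addrC z c) => {}H.
have -> : u * ((F (c + z) - F c) / z) - u * d = u * ((F (c + z) - F c - d * z) / z).
  by field.
rewrite !normcM normcV mulrA ler_pdivrMr ?normc_gt0//.
apply: le_trans (ler_wpM2l (normc_ge0 _) H) _.
rewrite mulrA ler_wpM2r ?normc_ge0// mulrCA -[leRHS]mulr1 ler_wpM2l ?(ltW e0)//.
by rewrite ler_pdivrMr// mul1r lerDr.
Qed.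

Lemma slope_continuous_circle F c r rad u : 0 < r -> r < rad ->
  (forall z, normc (z - c) < rad -> derivable F z 1) ->
  continuous (fun t => complex.Re (u * ((F (c + circ r t) - F c) / circ r t))).
Proof.
move=> r0 rr dF.
apply: (@continuous_circle (fun z => u * ((F (c + z) - F c) / z))) => // t.
apply: derivable_cstM; apply: derivable_slope; first exact: circle_neq0.
by apply: dF; rewrite addrC addKr normc_circle.
Qed.

(** Estimates are obtained on circles strictly inside a disc; this lets their radius tend to that of
    the disc. *)
Lemma le_limit_scale x y rad : 0 < rad ->
  (forall r, 0 < r -> r < rad -> r * x <= y) -> rad * x <= y.
Proof.
move=> rad0 H; rewrite leNgt; apply/negP => lt.
have h0 : 0 < rad / 2 by rewrite divr_gt0.
have h1 : rad / 2 < rad by rewrite ltr_pdivrMr// ltr_pMr// ltr1n.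
have [x0|x0] := leP x 0.
  have := H _ h0 h1; rewrite leNgt => /negP; apply; apply: lt_le_trans lt _.
  by rewrite ler_wnM2r// ltW.
have h2 : y / x < rad by rewrite ltr_pdivrMr.
pose r := Num.max (rad / 2) ((y / x + rad) / 2).
have r0 : 0 < r by rewrite lt_max h0.
have rr : r < rad by rewrite gt_max h1 midf_lt.
have := H r r0 rr; rewrite -ler_pdivlMr// leNgt => /negP; apply.
by rewrite lt_max; apply/orP; right; rewrite midf_lt.
Qed.

(** The mean of the slope over a circle of radius [r] is [d], and the slope is at most [2 * M / r]
    there; the factor 2 comes from subtracting [F c]. *)
Lemma cauchy_estimate F c d rad M : 0 < rad ->
  (forall z, normc (z - c) < rad -> derivable F z 1) -> is_derive c 1 F d ->
  (forall z, normc (z - c) < rad -> normc (F z) <= M) -> rad * normc d <= 2 * M.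
Proof.
move=> rad0 dF dc FM; have [u u1 uE] := rotation d.
have rP r : 0 < r -> r < rad -> r * normc d <= 2 * M.
  move=> r0 rr; have := mean_value_slope u r0 rr dF dc.
  rewrite uE [complex.Re _%:C]/= => E.
  have := @ointegral_norm_le _ (2 * M / r) _ 0 T T0 (@slope_continuous_circle F c r rad u r0 rr dF).
  rewrite E subr0 normrM (gtr0_norm T0) ler_pM2r// ger0_norm ?normc_ge0//.
  rewrite ler_pdivlMr// [_ * r]mulrC; apply => t _.
  apply: le_trans (normc_ge_Re _) _.
  rewrite !normcM normcV u1 mul1r normc_circle// ler_pM2r ?invr_gt0//.
  apply: le_trans (ler_normcB _ _) _; rewrite mulr_natl mulr2n lerD// FM ?subrr//.
    by rewrite addrC addKr normc_circle.
  by rewrite ComplexField.Normc.normc0.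
exact: le_limit_scale.
Qed.

Lemma cauchy_estimate2 F c rad M h (dF : R[i] -> R[i]) : 0 < rad ->
  (forall z, normc (z - c) < rad -> is_derive z 1 F (dF z)) ->
  (forall z, normc (z - c) < rad -> normc (F z) <= M) -> normc h < rad / 4 ->
  normc (F (c + h) - F c - dF c * h) <= 64 * M / rad ^+ 2 * normc h ^+ 2.
Proof.
move=> rad0 dFP FM hr.
have M0 : 0 <= M.
  by apply: le_trans (normc_ge0 (F c)) (FM c _); rewrite subrr ComplexField.Normc.normc0.
have r2 : 0 < rad / 2 by rewrite divr_gt0.
have dF1 z : normc (z - c) < rad / 2 -> normc (dF z) <= 4 * M / rad.
  move=> zc; have sub w : normc (w - z) < rad / 2 -> normc (w - c) < rad.
    move=> wz; rewrite -(subrK z w) -addrA; apply: le_lt_trans (ler_normcD _ _) _.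
    by rewrite (splitr rad) ltrD.
  have := @cauchy_estimate F z (dF z) (rad / 2) M r2 _ _ _.
  rewrite ler_pdivlMr// => H.
  suff : rad / 2 * normc (dF z) <= 2 * M by rewrite mulrAC ler_pdivrMr//; lra.
  apply: H.
  - by move=> w /sub/dFP[].
  - by apply: dFP; apply: lt_trans zc _; rewrite ltr_pdivrMr// ltr_pMr// ltr1n.
  - by move=> w /sub/FM.
have dF2 w : normc w <= normc h ->
    normc (dF (c + w) - dF c) <= 32 * M / rad ^+ 2 * normc h.
  move=> wh; pose G z := F (w + z) - F z.
  have in1 z x : normc (z - c) < rad / 4 -> 0 <= x <= 1 ->
      normc (z + x%:C * w - c) < rad / 2.
    move=> zc /andP[x0 x1]; rewrite addrAC; apply: le_lt_trans (ler_normcD _ _) _.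
    rewrite normcM normcR ger0_norm//.
    have : x * normc w <= normc h by apply: le_trans wh; rewrite ler_piMl// normc_ge0.
    by move: zc hr; lra.
  have in2 z : normc (z - c) < rad / 2 -> normc (z - c) < rad.
    by move=> /lt_trans; apply; rewrite ltr_pdivrMr// ltr_pMr// ltr1n.
  have in0 z : normc (z - c) < rad / 4 -> normc (w + z - c) < rad / 2.
    by move=> zc; have := in1 z 1 zc; rewrite mul1r [z + w]addrC; apply; rewrite ler01 lexx.
  have in3 z : normc (z - c) < rad / 4 -> normc (z - c) < rad / 2.
    by move=> /lt_trans; apply; rewrite ltr_pM2l// ltf_pV2 ?posrE// ltr_nat.
  have dG z : normc (z - c) < rad / 4 -> is_derive z 1 G (dF (w + z) - dF z).
    move=> zc; apply: (is_deriveB (f := fun z => F (w + z))).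
      have dg : is_derive z 1 (fun z => w + z) 1.
        rewrite -[X in is_derive _ _ _ X]add0r.
        exact: (is_deriveD (is_derive_cst w z 1) (is_derive_id z 1)).
      rewrite -[X in is_derive _ _ _ X]mulr1; apply: (is_derive_compC dg).
      exact/dFP/in2/in0.
    exact/dFP/in2/in3.
  have cc : normc (c - c) < rad / 4.
    by rewrite subrr ComplexField.Normc.normc0 divr_gt0.
  have GM z : normc (z - c) < rad / 4 -> normc (G z) <= 4 * M / rad * normc h.
    move=> zc; rewrite /G addrC; apply: le_trans (_ : 4 * M / rad * normc w <= _).
      rewrite addrC [w + z]addrC; apply: (@mean_value_le _ F dF) => x xI.
        exact/dFP/in2/in1.
      exact/dF1/in1.
    by rewrite ler_wpM2l// !mulr_ge0// invr_ge0 ltW.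
  have := @cauchy_estimate G c (dF (w + c) - dF c) (rad / 4) _ _ _ (dG c cc) GM.
  rewrite divr_gt0// [w + c]addrC => /(_ isT _)H.
  have {}H := H (fun z zc => let: DeriveDef d _ := dG z zc in d).
  rewrite -(@ler_pM2l _ (rad / 4)) ?divr_gt0//; apply: le_trans H _.
  rewrite le_eqVlt; apply/orP; left; apply/eqP; field; exact: lt0r_neq0.
have := @mean_value_le _ (fun z => F z - dF c * z) (fun z => dF z - dF c) c h
  (32 * M / rad ^+ 2 * normc h).
have -> : F (c + h) - dF c * (c + h) - (F c - dF c * c) = F (c + h) - F c - dF c * h.
  by ring.
move=> H; apply: le_trans (H _ _) _.
- move=> x /andP[x0 x1]; apply: is_deriveB.
    apply: dFP; rewrite addrC addKr normcM normcR ger0_norm//.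
    apply: (@le_lt_trans _ _ (normc h)); first by rewrite ler_piMl// normc_ge0.
    by apply: lt_trans hr _; rewrite ltr_pdivrMr// ltr_pMr// ltr1n.
  exact: is_derive_linear.
- move=> x /andP[x0 x1]; apply: dF2.
  by rewrite normcM normcR ger0_norm// ler_piMl// normc_ge0.
rewrite -mulrA -expr2 ler_wpM2r ?sqr_ge0// ler_wpM2r ?invr_ge0 ?sqr_ge0//.
by rewrite ler_wpM2r// ler_nat.
Qed.

(** The integrand is the imaginary part of [e^(- i t) z]: the contribution of the constant [F c]
    that the slope subtracts in [schwarz_pick_disc]. *)
Lemma cis_mean0 (z : R[i]) :
  ointegral (fun t => complex.Im z * cos t - complex.Re z * sin t) 0 T = 0.
Proof.
pose P (t : R) := complex.Im z * sin t + complex.Re z * cos t.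
have P0 : P T - P 0 = 0 by rewrite /P cos2pi sin2pi cos0 sin0; ring.
rewrite -[RHS]P0; apply: ointegral_FTC => // [|t _].
  by apply: continuousB_fun => x; apply: cvgMl_tmp; [exact: continuous_cos|exact: continuous_sin].
rewrite -mulrN; exact: (is_deriveD (is_deriveZ (complex.Im z) (is_derive_sin t))
                                   (is_deriveZ (complex.Re z) (is_derive_cos t))).
Qed.

(* The mean over the circle of [F] against the nonnegative kernel
   [2 - z / r - r / z = 2 - 2 cos t] is [2 F(c) - r F'(c)]. *)
Lemma schwarz_pick_disc F c d rad : 0 < rad ->
  (forall z, normc (z - c) < rad -> derivable F z 1) -> is_derive c 1 F d ->
  (forall z, normc (z - c) < rad -> 0 <= complex.Im (F z)) ->
  rad * complex.Im d <= 2 * complex.Im (F c).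
Proof.
move=> rad0 dF dc F0; apply: le_limit_scale => // r r0 rr.
(* Multiplication by [- i] turns imaginary parts into the real parts handled by the mean value
   lemmas. *)
pose iN : R[i] := - 'i.
have ReN z : complex.Re (iN * z) = complex.Im z.
  by case: z => a b; rewrite /iN /=; ring.
(* The terms [2 - z / r] of the kernel; the term [r / z], singular at the centre, is left to
   [mean_value_slope]. *)
pose P z : R[i] := iN * ((2 + (- r^-1%:C) * z) * F (c + z)).
have dP z : normc z < rad -> derivable P z 1.
  move=> zr; apply: derivable_cstM; apply: derivable_affM; apply: dF.
  by rewrite addrC addKr.
have JP := @mean_value P r rad r0 rr dP.
have JQ := mean_value_slope iN r0 rr dF dc.
have cP : continuous (fun t => complex.Re (P (circ r t))).
  have dPc t : derivable P (circ r t) 1 by apply: dP; rewrite normc_circle.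
  exact: (continuous_circle r0 dPc).
have cQ := @slope_continuous_circle F c r rad iN r0 rr dF.
have cQr : continuous (fun t => r *
    complex.Re (iN * ((F (c + circ r t) - F c) / circ r t))).
  by move=> t; apply: cvgMl_tmp; exact: cQ.
have JB := ointegralB T0 cP cQr.
rewrite ointegralZ// JP JQ !ReN mulr0 !addr0 in JB.
have pos : 0 <= complex.Im (2 * F c) * T - r * (complex.Im d * T).
  rewrite -JB -[leLHS](cis_mean0 (F c)); apply: ointegral_le => //.
  - move=> t; apply: continuousB_fun => x; apply: cvgMl_tmp.
      exact: continuous_cos.
    exact: continuous_sin.
  - exact: continuousB_fun.
  - move=> t _; rewrite !ReN.
    have zc : normc (c + circ r t - c) < rad by rewrite addrC addKr normc_circle.
    have := F0 _ zc; move: (F (c + circ r t)) (F c) => [a b] [a' b'] /= b0.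
    have cs := cos2Dsin2 t; have c1 := cos_le1 t.
    have -> : ((r * cos t - 0 * sin t) ^+ 2 + (r * sin t + 0 * cos t) ^+ 2) = r ^+ 2.
      by rewrite !mul0r subr0 addr0 !exprMn -mulrDr cs mulr1.
    rewrite -subr_ge0 (_ : _ - _ = b * (2 - 2 * cos t)).
      by rewrite mulr_ge0//; lra.
    rewrite ?mul0r ?oppr0 ?add0r ?addr0 ?subr0.
    field.
    exact: lt0r_neq0.
move: pos; rewrite mulrA -mulrBl pmulr_lge0// subr_ge0.
by rewrite mulr_natl raddfMn mulr_natl.
Qed.

(* By [schwarz_pick_disc] on the disc of center [-s] and radius [1 - s], the
   quotient [Im F(-s) / (1 - s)^2] is nondecreasing. *)
Lemma harnack F s : 0 <= s -> s < 1 ->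
  (forall z, normc z < 1 -> derivable F z 1) ->
  (forall z, normc z < 1 -> 0 <= complex.Im (F z)) ->
  (1 - s) ^+ 2 * complex.Im (F 0) <= complex.Im (F (- s%:C)).
Proof.
rewrite le_eqVlt => /predU1P[<-|s0] s1 dF F0.
  by rewrite subr0 expr1n mul1r oppr0.
pose f x := complex.Im (F (0 + x%:C * -1)).
have inD x : 0 <= x <= s -> normc (0 + x%:C * -1) < 1.
  move=> /andP[x0 xs]; rewrite add0r mulrN1 normcN normcR ger0_norm//.
  exact: le_lt_trans s1.
pose d x := 'D_1 F (0 + x%:C * -1).
have dfx x : 0 <= x <= s -> is_derive x 1 f (- complex.Im (d x)).
  move=> /inD/dF/derivableP/is_derive_slice[_].
  by rewrite mulrN1 raddfN.
have d2 x : 0 <= x <= s -> (1 - x) * complex.Im (d x) <= 2 * f x.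
  move=> xs; have x1 : 0 < 1 - x by rewrite subr_gt0; case/andP: xs => _ /le_lt_trans; apply.
  have sub z : normc (z - (0 + x%:C * -1)) < 1 - x -> normc z < 1.
    move=> zx; rewrite -(subrK (0 + x%:C * -1) z); apply: le_lt_trans (ler_normcD _ _) _.
    rewrite -[X in _ < X](subrK x) ltr_leD// add0r mulrN1 normcN normcR ger0_norm//.
    by case/andP: xs.
  apply: schwarz_pick_disc => //.
  - by move=> z /sub/dF.
  - by apply/derivableP/dF/inD.
  - by move=> z /sub/F0.
pose k x : R := (1 - x)^-1.
have kd x : x < 1 -> is_derive x 1 k (k x ^+ 2).
  move=> x1; have d1 : is_derive x (1:R) (fun x : R => 1 - x) (0 - 1).
    exact: (is_deriveB (is_derive_cst (1:R) x 1) (is_derive_id x 1)).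
  have x0 : 1 - x != 0 by rewrite subr_eq0 gt_eqF.
  have := is_deriveV (f := fun x : R => 1 - x) x0 d1.
  rewrite sub0r [_ *: _]mulrN1 opprK => h.
  by rewrite /k exprVn; exact: h.
pose g x := f x * (k x * k x).
pose dg x := f x * (k x * k x ^+ 2 + k x * k x ^+ 2) + (k x * k x) * (- complex.Im (d x)).
have gd x : 0 <= x <= s -> is_derive x 1 g (dg x).
  move=> xs; have x1 : x < 1 by case/andP: xs => _ /le_lt_trans; apply.
  exact: (is_deriveM (dfx x xs) (is_deriveM (kd x x1) (kd x x1))).
have cg : {within `[0, s], continuous g}.
  apply: derivable_within_continuous => x; rewrite in_itv/= => /gd.
  by case.
have [x] := MVT s0 (fun x xI => gd x (subset_itv_oo_cc xI)) cg.
move=> /subset_itv_oo_cc; rewrite /= in_itv/= => xs gE.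
have x1 : 0 < 1 - x by rewrite subr_gt0; case/andP: xs => _ /le_lt_trans; apply.
have g01 : g 0 <= g s.
  rewrite -subr_ge0 gE mulr_ge0//; last by rewrite subr0 ltW.
  have kx : 0 < k x by rewrite invr_gt0.
  have -> : dg x = k x ^+ 3 * (2 * f x - (1 - x) * complex.Im (d x)).
    by rewrite /dg /k; field; exact: lt0r_neq0.
  by rewrite mulr_ge0 ?exprn_ge0 ?(ltW kx)// subr_ge0 d2.
move: g01; rewrite /g /k subr0 invr1 !mulr1 /f mul0r addr0 add0r mulrN1.
rewrite -invfM -expr2 ler_pdivlMr 1?mulrC//.
by rewrite exprn_gt0// subr_gt0.
Qed.

Lemma mean_value_bound q r rad M : 0 < r -> r < rad ->
  (forall z, normc z < rad -> derivable q z 1) ->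
  (forall z, normc z = r -> normc (q z) <= M) -> normc (q 0) <= M.
Proof.
move=> r0 rr dq qM; have [u u1 uE] := rotation (q 0).
have duq z : normc z < rad -> derivable (fun z => u * q z) z 1.
  by move=> /dq; exact: derivable_cstM.
have JE := mean_value r0 rr duq.
have dc t : derivable (fun z => u * q z) (circ r t) 1.
  by apply: duq; rewrite normc_circle.
have := @ointegral_norm_le _ M _ 0 T T0 (continuous_circle r0 dc).
rewrite JE uE /= subr0 normrM (gtr0_norm T0) ler_pM2r// ger0_norm ?normc_ge0//.
apply => t _; apply: le_trans (normc_ge_Re _) _.
by rewrite normcM u1 mul1r qM// normc_circle.
Qed.

Lemma exprn_small x M e : 0 <= x -> x < 1 -> 0 < e -> exists m, M * x ^+ m <= e.
Proof.
move=> x0 x1 e0; have : M * x ^+ n @[n --> \oo] --> M * 0.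
  by apply: cvgMl_tmp; apply: cvg_expr; rewrite ger0_norm.
rewrite mulr0 => /cvgrPdist_le/(_ e e0)[m _ /(_ m (leqnn m))].
by rewrite /= sub0r normrN => H; exists m; apply: le_trans H; exact: ler_norm.
Qed.

Lemma normcX z m : normc (z ^+ m) = normc z ^+ m.
Proof. by apply: complexI; rewrite rmorphXn/= -!normC normrX. Qed.

Lemma sqr_normcE (a b : R) : normc (a +i* b) ^+ 2 = a ^+ 2 + b ^+ 2.
Proof. by rewrite /= sqr_sqrtr// addr_ge0 ?sqr_ge0. Qed.

(** Divided by the first square, this computes [1 - |phi z|^2] for the automorphism
    [phi z = (p + z) / (1 + conj(p) z)] of the disc. *)
Lemma moebius_normc (p z : R[i]) :
  normc (1 + p^* * z) ^+ 2 - normc (p + z) ^+ 2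
  = (1 - normc p ^+ 2) * (1 - normc z ^+ 2).
Proof.
move: p z => [a b] [x y]; rewrite !sqr_normcE /=.
ring.
Qed.

(* [K / z ^ m] is still holomorphic, hence [K p] is at most [M (|p| / c) ^ m]
   if [c] bounds from below the modulus on the curve obtained from a circle
   around [0] by the automorphism of the disc that moves [0] to [p]. *)
Lemma disc_identity K M e : 0 < e ->
  (forall z, normc z < 1 -> derivable K z 1) ->
  (forall z, normc z < 1 -> normc (K z) <= M) ->
  (forall z, normc z < e -> K z = 0) ->
  forall p, normc p < 1 -> K p = 0.
Proof.
move=> e0 dK KM K0 p p1; have [->|pn0] := eqVneq p 0.
  by apply: K0; rewrite ComplexField.Normc.normc0.
pose s : R := normc p; have s0 : 0 < s by rewrite normc_gt0.
have M0 : 0 <= M by apply: le_trans (normc_ge0 _) (KM p p1).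
pose phi z : R[i] := (p + 1 * z) / (1 + p^* * z).
have np : normc p^* = s by apply: complexI; rewrite -!normC normcJ.
have den z : normc z < 1 -> 1 - s <= normc (1 + p^* * z).
  move=> z1; have := ler_normcB (1 + p^* * z) (p^* * z).
  rewrite addrK ComplexField.Normc.normc1 normcM np.
  have : s * normc z <= s by rewrite ler_piMr ?ltW.
  lra.
have den0 z : normc z < 1 -> 0 < normc (1 + p^* * z).
  by move=> /den; apply: lt_le_trans; rewrite subr_gt0.
have phiE z : normc z < 1 -> normc (phi z) ^+ 2 =
    1 - (1 - s ^+ 2) * (1 - normc z ^+ 2) / normc (1 + p^* * z) ^+ 2.
  move=> /den0 z1; rewrite -moebius_normc /phi mul1r normcM normcV.
  by field; exact: lt0r_neq0.
have phi1 z : normc z < 1 -> normc (phi z) < 1.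
  move=> z1; rewrite -(@expr_lt1 _ 2) ?normc_ge0// phiE// gtrDl oppr_lt0.
  rewrite divr_gt0 ?exprn_gt0 ?den0// mulr_gt0// subr_gt0 expr_lt1 ?normc_ge0//.
have dphi z : normc z < 1 -> derivable phi z 1.
  move=> z1; apply: derivable_moebius.
  by rewrite -normc_gt0 den0.
pose L m z : R[i] := K z * (z ^+ m)^-1.
have dL m z : normc z < 1 -> derivable (L m) z 1.
  (* At [0] the quotient is harmless, since [K] vanishes on a neighbourhood. *)
  move=> z1; have [zz|z0] := eqVneq z 0.
    apply: (near_eq_derivable (f := cst 0)); last exact: derivable_cst.
    apply/nbhs_ballP; exists e%:C; first by rewrite /= ltcR.
    move=> w; rewrite -ball_normE /= zz sub0r normrN normC ltcR => we.
    by rewrite /L K0// mul0r.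
  exact: (derivable_divX z0 (dK z z1)).
(* Chosen so that [(1 - s^2) (1 - r^2) / (1 - s)^2 = (1 - s^2) / 2]. By [phiE] and [den], |phi z|^2
   is then at least [(1 + s^2) / 2 = c^2 > s^2] on the circle of radius [r]. *)
pose r2 : R := 1 - (1 - s) ^+ 2 / 2; pose r : R := Num.sqrt r2.
have s12 : (1 - s) ^+ 2 <= 1.
  have h1 : 0 <= 1 - s by rewrite subr_ge0 ltW.
  have h2 : 1 - s <= 1 by rewrite gerBl ltW.
  by rewrite expr_le1.
have s120 : 0 < (1 - s) ^+ 2 by rewrite exprn_gt0// subr_gt0.
have r20 : 0 < r2 by rewrite /r2; lra.
have r0 : 0 < r by rewrite sqrtr_gt0.
have rE : r ^+ 2 = r2 by rewrite sqr_sqrtr// ltW.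
have r1 : r < 1 by rewrite -(@expr_lt1 _ 2) ?(ltW r0)// rE /r2; lra.
pose c : R := Num.sqrt ((1 + s ^+ 2) / 2).
have cs : s < c.
  rewrite -(@ltr_pXn2r _ 2) ?nnegrE ?(ltW s0) ?sqrtr_ge0// sqr_sqrtr.
    have : s ^+ 2 < 1 by rewrite expr_lt1 ?(ltW s0).
    lra.
  by rewrite divr_ge0// addr_ge0// sqr_ge0.
have c0 : 0 < c by apply: lt_trans cs.
have phic z : normc z = r -> c <= normc (phi z).
  move=> zr; have z1 : normc z < 1 by rewrite zr.
  rewrite -(@ler_pXn2r _ 2) ?nnegrE ?normc_ge0 ?sqrtr_ge0// sqr_sqrtr; last first.
    by rewrite divr_ge0// addr_ge0// sqr_ge0.
  rewrite phiE// zr rE.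
  have q1 : (1 - s ^+ 2) * (1 - r2) / normc (1 + p^* * z) ^+ 2 <= (1 - s ^+ 2) / 2.
    rewrite ler_pdivrMr ?exprn_gt0 ?den0// -mulrA ler_wpM2l//.
      by rewrite subr_ge0 expr_le1// ?ltW.
    rewrite /r2 opprB addrCA subrr addr0 mulrC ler_wpM2l//.
    by rewrite ler_pXn2r ?nnegrE ?normc_ge0 ?den// subr_ge0 ltW.
  by move: q1; lra.
have bound m : normc (K p) <= M * (s / c) ^+ m.
  have dq z : normc z < 1 -> derivable (L m \o phi) z 1.
    move=> z1; have /derivableP d1 := dphi z z1.
    have /derivableP d2 := dL m _ (phi1 z z1).
    by have [] := is_derive_compC d1 d2.
  (* As [phi 0 = p], the value at the centre is [K p / p ^+ m]. *)
  have := @mean_value_bound (L m \o phi) r 1 (M / c ^+ m) r0 r1 dq.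
  have -> : (L m \o phi) 0 = K p / p ^+ m.
    by rewrite /= /L /phi !mulr0 !addr0 divr1.
  move=> /(_ _)/wrap[].
    move=> z zr; have z1 : normc z < 1 by rewrite zr.
    rewrite /= /L normcM normcV normcX; apply: ler_pM.
    - exact: normc_ge0.
    - by rewrite invr_ge0 exprn_ge0// normc_ge0.
    - exact/KM/phi1.
    - rewrite lef_pV2 ?posrE ?exprn_gt0//; last exact: lt_le_trans (phic z zr).
      by rewrite lerXn2r ?nnegrE ?normc_ge0 ?(ltW c0)// phic.
  rewrite normcM normcV normcX ler_pdivrMr ?exprn_gt0//.
  by rewrite expr_div_n mulrA mulrAC.
apply/eqP; rewrite -normc_eq0 -[_ == _]/(_ == _) eq_le normc_ge0 andbT.
apply/ler_addgt0Pr => d d0; rewrite add0r.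
have sc : s / c < 1 by rewrite ltr_pdivrMr// mul1r.
have [|m] := @exprn_small (s / c) M d _ sc d0; first by rewrite divr_ge0 ?ltW.
exact: le_trans (bound m).
Qed.

(** The imaginary part of ['i * (A1 - A0)] is the real part of [A1 - A0], and that of [A2 - A0] is
    at most [2 * r] because [B0] and [B2] are real. Passing from [A1], [A0] to [B1], [B0] costs
    another [2 * r]. *)
Lemma real_increment (A0 A1 A2 B0 B1 B2 : R[i]) r s :
  complex.Im B0 = 0 -> complex.Im B2 = 0 ->
  normc (A0 - B0) <= r -> normc (A1 - B1) <= r -> normc (A2 - B2) <= r ->
  normc (A2 - A0 - 'i * (A1 - A0)) <= s ->
  `|complex.Re B1 - complex.Re B0| <= s + 4 * r.
Proof.
move=> B0R B2R /[dup] /(le_trans (normc_ge_Re _)) R0 /(le_trans (normc_ge_Im _)) I0.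
move=> /(le_trans (normc_ge_Re _)) R1 /(le_trans (normc_ge_Im _)) I2.
move=> /(le_trans (normc_ge_Im _)); move: R0 I0 R1 I2 B0R B2R.
case: A0 A1 A2 B0 B1 B2 => [? ?] [? ?] [? ?] [? ?] [? ?] [? ?] /=.
rewrite !ler_norml => /andP[? ?] /andP[? ?] /andP[? ?] /andP[? ?] ? ? /andP[? ?].
by apply/andP; split; lra.
Qed.

(* By [cauchy_estimate2], the increments of [a i] along [s] and along [i s]
   differ by the factor [i] up to O(s^2); this passes to the limit [a0], which is
   real, so that the increments of [a0] are O(s^2). *)
Lemma real_limit_constant (a : R -> R[i] -> R[i]) (a0 : R[i] -> R[i]) M i0 : 0 < i0 ->
  (forall i z, 0 < i < i0 -> normc z < 2 -> derivable (a i) z 1) ->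
  (forall i z, 0 < i < i0 -> normc z < 2 -> normc (a i z) <= M) ->
  (forall z, normc z < 2 -> forall e, 0 < e -> exists2 de, 0 < de &
     forall i, 0 < i < de -> normc (a i z - a0 z) <= e) ->
  (forall z, normc z < 2 -> complex.Im (a0 z) = 0) ->
  a0 1 = a0 0.
Proof.
move=> i00 da aM acv a0R.
have M0 : 0 <= M.
  have z2 : normc (0 : R[i]) < 2 by rewrite ComplexField.Normc.normc0.
  have hi : 0 < i0 / 2 < i0.
    by rewrite divr_gt0// ltr_pdivrMr// ltr_pMr// ltr1n.
  exact: le_trans (normc_ge0 _) (aM _ 0 hi z2).
have disc x h : 0 <= x <= 1 -> normc h < 1 -> normc (x%:C + h) < 2.
  move=> /andP[x0 x1] h4; apply: le_lt_trans (ler_normcD _ _) _.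
  by rewrite normcR ger0_norm//; lra.
(* [cauchy_estimate2] is used on the unit disc around [x], which lies in the disc of radius 2; hence
   the bound [1 / 4]. *)
have key x s : 0 <= x <= 1 -> `|s| < 1 / 4 ->
    `|complex.Re (a0 (x + s)%:C) - complex.Re (a0 x%:C)| <= 128 * M * s ^+ 2.
  move=> xI s4; have s1 : `|s| < 1 by lra.
  pose c : R[i] := x%:C; pose h1 : R[i] := s%:C; pose h2 : R[i] := 'i * h1.
  have nh1 : normc h1 = `|s| by exact: normcR.
  have nh2 : normc h2 = `|s|.
    by rewrite normcM nh1 /= expr0n expr1n add0r sqrtr1 mul1r.
  have c2 : normc c < 2 by rewrite -[c]addr0 disc// ComplexField.Normc.normc0.
  have ch1 : normc (c + h1) < 2 by rewrite disc// nh1.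
  have ch2 : normc (c + h2) < 2 by rewrite disc// nh2.
  apply/ler_addgt0Pr => e e0; have e40 : 0 < e / 4 by rewrite divr_gt0.
  have [d0 d00 H0] := acv c c2 _ e40.
  have [d1 d10 H1] := acv _ ch1 _ e40.
  have [d2 d20 H2] := acv _ ch2 _ e40.
  pose m := Num.min (Num.min d0 d1) (Num.min d2 i0); pose i := m / 2.
  have m0 : 0 < m by rewrite !lt_min d00 d10 d20 i00.
  have i_gt0 : 0 < i by rewrite divr_gt0.
  have : i < m by rewrite ltr_pdivrMr// ltr_pMr// ltr1n.
  rewrite !lt_min => /andP[/andP[id0 id1] /andP[id2 ii0]].
  have iI : 0 < i < i0 by rewrite i_gt0.
  have {}H0 : normc (a i c - a0 c) <= e / 4 by apply: H0; rewrite i_gt0.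
  have {}H1 : normc (a i (c + h1) - a0 (c + h1)) <= e / 4 by apply: H1; rewrite i_gt0.
  have {}H2 : normc (a i (c + h2) - a0 (c + h2)) <= e / 4 by apply: H2; rewrite i_gt0.
  have sub z : normc (z - c) < 1 -> normc z < 2.
    by move=> zc; rewrite -(subrK c z) addrC disc.
  have est h : normc h = `|s| ->
      normc (a i (c + h) - a i c - 'D_1 (a i) c * h) <= 64 * M * s ^+ 2.
    move=> nh; have := @cauchy_estimate2 (a i) c 1 M h (fun z => 'D_1 (a i) z) ltr01.
    rewrite expr1n divr1 nh real_normK ?num_real//; apply => //.
    - by move=> z /sub zc; apply/derivableP/da.
    - by move=> z /sub zc; apply: aM.
  have E1 := est _ nh1; have E2 := est _ nh2.
  set D := 'D_1 (a i) c in E1 E2.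
  (* The linear terms [D * h2] and ['i * (D * h1)] are equal and cancel. *)
  have E : normc (a i (c + h2) - a i c - 'i * (a i (c + h1) - a i c)) <= 128 * M * s ^+ 2.
    have -> : a i (c + h2) - a i c - 'i * (a i (c + h1) - a i c) =
      (a i (c + h2) - a i c - D * h2) - 'i * (a i (c + h1) - a i c - D * h1).
      by rewrite /h2; ring.
    apply: le_trans (ler_normcB _ _) _; rewrite normcM [normc 'i]/=.
    rewrite expr0n expr1n add0r sqrtr1 mul1r; lra.
  have -> : (x + s)%:C = c + h1 by rewrite rmorphD.
  have -> : 128 * M * s ^+ 2 + e = 128 * M * s ^+ 2 + 4 * (e / 4).
    by congr (_ + _); field.
  by apply: real_increment H0 H1 H2 E; exact: a0R.
pose f x := complex.Re (a0 (0 + x%:C * 1)).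
have fd x : 0 <= x <= 1 -> is_derive x 1 f 0.
  move=> xI; apply: dist_is_derive => e e0.
  have k0 : 0 < 128 * M + 1 by rewrite ltr_wpDl// mulr_ge0.
  exists (Num.min (1 / 4) (e / (128 * M + 1))); first by rewrite lt_min !divr_gt0.
  move=> y; rewrite lt_min => /andP[y4 ye]; rewrite mul0r subr0 /f !add0r !mulr1.
  have := key x (y - x) xI y4; have -> : x + (y - x) = y by ring.
  move=> H; apply: le_trans H _.
  rewrite -real_normK ?num_real// expr2 mulrA ler_wpM2r//.
  rewrite ltr_pdivlMr// in ye; apply: le_trans (ltW ye).
  by rewrite mulrC ler_wpM2l// lerDl.
have cf : {within `[0, 1], continuous f}.
  apply: derivable_within_continuous => x; rewrite in_itv/= => /fd.
  by case.
have [x _] := MVT ltr01 (fun x xI => fd x (subset_itv_oo_cc xI)) cf.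
rewrite mul0r => /eqP; rewrite subr_eq0 /f mul0r mulr1 !add0r => /eqP E.
apply/eqP; rewrite eq_complex E !a0R ?eqxx//.
  by rewrite ComplexField.Normc.normc0.
by rewrite ComplexField.Normc.normc1 ltr1n.
Qed.

End mean_value_consequences.

(** * Maps from the polyhalfplane to the half-plane *)

Lemma is_derive_comp_rV (K : numFieldType) n (F : 'rV[K]_n -> K)
    (psi : K -> 'rV[K]_n) (z : K) (d : 'rV[K]_n) :
  differentiable F (psi z) ->
  (forall j, is_derive z 1 (fun w => psi w 0 j) (d 0 j)) ->
  is_derive z 1 (F \o psi) (\sum_j d 0 j * 'D_(delta_mx 0 j) F (psi z)).
Proof.
move=> dF dpsi.
have dpsi1 j : is_derive z 1 (fun w => psi w 0 j *: (delta_mx 0 j : 'rV[K]_n))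
    (d 0 j *: (delta_mx 0 j : 'rV[K]_n)).
  have [d1 dE] := dpsi j; have d2 := (derivable1_diffP _ _).1 d1.
  apply: DeriveDef; first exact/derivable1_diffP/differentiableZl.
  by rewrite deriveE ?diffZl -?dE ?deriveE//; exact: differentiableZl.
have dpsis := is_derive_sum dpsi1.
have psiE : \sum_(j < n) (fun w => psi w 0 j *: (delta_mx 0 j : 'rV[K]_n)) = psi.
  by apply/funext => w; rewrite fct_sumE -row_sum_delta.
rewrite psiE -row_sum_delta in dpsis; have [dp pE] := dpsis.
have dpz : differentiable psi z by apply/derivable1_diffP.
have dc : differentiable (F \o psi) z by exact: differentiable_comp.
apply: DeriveDef; first exact/derivable1_diffP.
rewrite deriveE// diff_comp//= -[X in 'd F _ X](@deriveE _ _ _ psi)// pE.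
rewrite [X in 'd F _ X]row_sum_delta linear_sum; apply: eq_bigr => j _.
by rewrite linearZ deriveE.
Qed.

Lemma is_derive_affine (K : numFieldType) (x y w : K) :
  is_derive w 1 (fun z => x + y * z) y.
Proof.
rewrite -[X in is_derive _ _ _ X]add0r.
exact: (is_deriveD (is_derive_cst x w 1) (is_derive_linear y w)).
Qed.

Lemma is_derive_moebius (K : numFieldType) (a b k : K) :
  is_derive (0 : K) 1 (fun z : K => (a + b * z) / (1 + k * z)) (b - a * k).
Proof.
have n0 : 1 + k * 0 != 0 :> K by rewrite mulr0 addr0 oner_eq0.
have [d1 dE1] := is_derive_affine a b 0; have [d2 dE2] := is_derive_affine 1 k 0.
apply: DeriveDef; first by apply: derivableM => //; exact: derivableV.
rewrite deriveM//; last exact: derivableV.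
rewrite deriveV// dE1 dE2 !mulr0 !addr0 expr1n invr1 /GRing.scale/=; ring.
Qed.

Lemma derivable_quotient (K : numFieldType) (f g : K -> K) (z : K) :
  derivable f z 1 -> derivable g z 1 -> g z != 0 -> derivable (fun w => f w / g w) z 1.
Proof.
by move=> df dg g0; apply: derivableM; [exact: df|exact: derivableV].
Qed.

Section several_variables.
Context {R : realType} {n : nat}.
Implicit Types (f : maps R n) (z w u v : 'rV[R[i]]_n) (a b c : R[i]) (e r s : R).
Local Notation Hn := (polyhalfplane R n).

Definition polydisc z r : set 'rV[R[i]]_n :=
  [set w | forall j, normc (w 0 j - z 0 j) < r].

Lemma nbhs_polydisc z (P : set 'rV[R[i]]_n) : nbhs z P ->
  exists2 r, 0 < r & polydisc z r `<=` P.
Proof.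
move=> /nbhs_ballP[e /=]; rewrite ltcE /= => /andP[/eqP ei er] eP.
exists (complex.Re e) => // w zw; apply: eP; split=> [|i j].
  by rewrite ltcE /= ei eqxx.
rewrite ord1 -ball_normE /= normC ltcE /= ei eqxx /= normcBC; exact: zw.
Qed.

Lemma ext_halfplane f z : Hn z -> 0 < complex.Im (ext f z).
Proof. by move=> Hz; rewrite (extE f Hz); exact: (set_valP (f _)). Qed.

Lemma is_derive_ext f (psi : R[i] -> 'rV[R[i]]_n) a (d : 'rV[R[i]]_n) :
  holomorphic f -> Hn (psi a) ->
  (forall j, is_derive a 1 (fun b => psi b 0 j) (d 0 j)) ->
  is_derive a 1 (fun b => ext f (psi b)) (\sum_j d 0 j * partial f j (psi a)).
Proof. by move=> hf Ha; apply: is_derive_comp_rV; exact: hf. Qed.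

Lemma is_derive_ext_line f z v a : holomorphic f -> Hn (z + a *: v) ->
  is_derive a 1 (fun b => ext f (z + b *: v)) (\sum_j v 0 j * partial f j (z + a *: v)).
Proof.
move=> hf Ha; apply: (is_derive_ext (psi := fun b => z + b *: v)) => // j.
have -> : (fun b : R[i] => (z + b *: v) 0 j) = (fun b => z 0 j + v 0 j * b).
  by apply/funext => b; rewrite !mxE mulrC.
exact: is_derive_affine.
Qed.

(** Multiplied by [|1 - b|^2], the imaginary part becomes [Im a * (1 - |b|^2)]. *)
Lemma halfplane_moebius a b : 0 < complex.Im a -> normc b < 1 ->
  0 < complex.Im ((a - a^* * b) / (1 - b)).
Proof.
move=> a0 b1; have n0 : 0 < normc (1 - b).
  by rewrite normc_gt0 subr_eq0; apply/eqP => b1'; move: b1; rewrite -b1' ComplexField.Normc.normc1 ltxx.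
have n2 : 0 < normc (1 - b) ^+ 2 by rewrite exprn_gt0.
have b2 : normc b ^+ 2 < 1 by rewrite expr_lt1 ?normc_ge0.
have -> : (a - a^* * b) / (1 - b) = (normc (1 - b) ^- 2)%:C * ((a - a^* * b) * (1 - b)^*).
  rewrite invc_norm normC -rmorphXn/= -rmorphV/= ?unitfE ?gt_eqF//; ring.
suff : 0 < complex.Im ((a - a^* * b) * (1 - b)^*).
  move: (_ * _^*) => [x y] /= y0; rewrite mul0r addr0 mulr_gt0// invr_gt0//.
case: a a0 b2 {n0 n2 b1} => a a'; case: b => b b' /= a0; rewrite sqr_sqrtr ?addr_ge0 ?sqr_ge0// => b2.
rewrite [ltRHS](_ : _ = a' * (1 - (b ^+ 2 + b' ^+ 2))); last by ring.
by rewrite mulr_gt0// subr_gt0.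
Qed.

(* For unimodular [u], the disc through [z] on which an extremal map with
   [u_j d_j f(z) >= 0] attains equality in the Schwarz-Pick inequality. *)
Definition moebius_disc z u a : 'rV[R[i]]_n :=
  \row_j ((z 0 j + - ((z 0 j)^* * u 0 j) * a) / (1 + - u 0 j * a)).

Lemma moebius_disc_halfplane z u a : Hn z -> (forall j, normc (u 0 j) <= 1) ->
  normc a < 1 -> Hn (moebius_disc z u a).
Proof.
move=> Hz u1 a1 j; rewrite /halfplane /= mxE.
have ua : normc (u 0 j * a) < 1.
  rewrite normcM; apply: le_lt_trans a1; rewrite ler_piMl ?normc_ge0 ?u1//.
by have := halfplane_moebius (Hz j) ua; rewrite mulrA !mulNr.
Qed.

Lemma moebius_disc0 z u : moebius_disc z u 0 = z.
Proof. by apply/rowP => j; rewrite mxE !mulr0 !addr0 divr1. Qed.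

Lemma moebius_den a b : normc b <= 1 -> normc a < 1 -> 1 + - b * a != 0.
Proof.
move=> b1 a1; rewrite mulNr subr_eq0; apply/eqP => E.
have : normc (b * a) < 1.
  by rewrite normcM; apply: le_lt_trans a1; rewrite ler_piMl ?normc_ge0.
by rewrite -E ComplexField.Normc.normc1 ltxx.
Qed.

Lemma derivable_ext_moebius f z u a : holomorphic f -> Hn z ->
  (forall j, normc (u 0 j) <= 1) -> normc a < 1 ->
  derivable (fun b => ext f (moebius_disc z u b)) a 1.
Proof.
move=> hf Hz u1 a1.
pose d : 'rV[R[i]]_n := \row_j 'D_1 (fun b => moebius_disc z u b 0 j) a.
have H j : is_derive a 1 (fun b => moebius_disc z u b 0 j) (d 0 j).
  rewrite mxE; apply/derivableP.
  have -> : (fun b => moebius_disc z u b 0 j) = (fun b =>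
      (z 0 j + - ((z 0 j)^* * u 0 j) * b) / (1 + - u 0 j * b)).
    by apply/funext => b; rewrite mxE.
  by apply: derivable_moebius; exact: moebius_den.
by have [] := is_derive_ext hf (moebius_disc_halfplane Hz u1 a1) H.
Qed.

(** The coordinates of the disc have derivative [(z_j - conj(z_j)) u_j = 2 i Im(z_j) u_j] at [0]. *)
Lemma is_derive_ext_moebius0 f z u : holomorphic f -> Hn z ->
  (forall j, normc (u 0 j) <= 1) ->
  is_derive (0 : R[i]) 1 (fun b => ext f (moebius_disc z u b))
    ('i%C * (2 * \sum_j (complex.Im (z 0 j))%:C * u 0 j * partial f j z)).
Proof.
move=> hf Hz u1.
pose d : 'rV[R[i]]_n := \row_j (- ((z 0 j)^* * u 0 j) - z 0 j * - u 0 j).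
have H j : is_derive (0 : R[i]) 1 (fun b => moebius_disc z u b 0 j) (d 0 j).
  have -> : (fun b => moebius_disc z u b 0 j) = (fun b =>
      (z 0 j + - ((z 0 j)^* * u 0 j) * b) / (1 + - u 0 j * b)).
    by apply/funext => b; rewrite mxE.
  by rewrite mxE; exact: is_derive_moebius.
have H0 : Hn (moebius_disc z u 0) by rewrite moebius_disc0.
have := is_derive_ext hf H0 H; rewrite moebius_disc0.
congr is_derive; rewrite 2!mulr_sumr; apply: eq_bigr => j _; rewrite mxE.
have -> : - ((z 0 j)^* * u 0 j) - z 0 j * - u 0 j = (z 0 j - (z 0 j)^*) * u 0 j by ring.
by rewrite subcJ; ring.
Qed.

Lemma ImN c : complex.Im (- c) = - complex.Im c.
Proof. by case: c. Qed.

Lemma Im_i2M c : complex.Im ('i%C * (2 * c)) = 2 * complex.Re c.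
Proof. by rewrite mulrC ImiRe mulr_natl [RHS]mulr_natl raddfMn. Qed.

(** This is [schwarz_pick_disc] at the centre of the unit disc, where both sides carry a factor 2.
    Choosing each [u 0 j] to cancel the argument of [partial f j z] gives the form with moduli. *)
Lemma schwarz_pick f z u : holomorphic f -> Hn z -> (forall j, normc (u 0 j) <= 1) ->
  \sum_j complex.Im (z 0 j) * complex.Re (u 0 j * partial f j z) <= complex.Im (ext f z).
Proof.
move=> hf Hz u1; have F0 := is_derive_ext_moebius0 hf Hz u1.
have := @schwarz_pick_disc _ (fun b => ext f (moebius_disc z u b)) 0 _ 1 ltr01 _ F0 _.
rewrite mul1r moebius_disc0.
rewrite Im_i2M.
rewrite ler_pM2l// raddf_sum /= => H.
apply: le_trans (H _ _).
- rewrite le_eqVlt; apply/orP; left; apply/eqP/eq_bigr => j _.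
  by rewrite -mulrA; case: (u 0 j * _) => x y /=; rewrite mul0r subr0.
- by move=> a; rewrite subr0 => a1; exact: derivable_ext_moebius.
- move=> a; rewrite subr0 => a1.
  exact/ltW/ext_halfplane/moebius_disc_halfplane.
Qed.

Lemma harnack_ext f z u s : holomorphic f -> Hn z -> (forall j, normc (u 0 j) <= 1) ->
  0 <= s -> s < 1 ->
  (1 - s) ^+ 2 * complex.Im (ext f z) <= complex.Im (ext f (moebius_disc z u (- s%:C))).
Proof.
move=> hf Hz u1 s0 s1.
have := @harnack _ (fun b => ext f (moebius_disc z u b)) s s0 s1 _ _.
rewrite moebius_disc0; apply => a a1; first exact: derivable_ext_moebius.
exact/ltW/ext_halfplane/moebius_disc_halfplane.
Qed.

(** The defect in Harnack's inequality at [s = 1 / (k + 2)], divided by [s]; the shift by 2 keeps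
    [s < 1] for every [k]. It is a real linear combination of two evaluations of [f]. *)
Definition harnack_gap f z u (k : nat) : R := k.+2%:R *
  (complex.Im (ext f (moebius_disc z u (- (k.+2%:R^-1)%:C)))
   - (1 - k.+2%:R^-1) ^+ 2 * complex.Im (ext f z)).

Lemma harnack_gap_ge0 f z u k : holomorphic f -> Hn z ->
  (forall j, normc (u 0 j) <= 1) -> 0 <= harnack_gap f z u k.
Proof.
move=> hf Hz u1; rewrite mulr_ge0// subr_ge0 harnack_ext//.
by rewrite invf_lt1// ltr1n.
Qed.

(** With [F] the restriction of [f] to the disc, [(Im F(-s) - Im F(0)) / s] tends to [- Im F'(0)],
    and [(1 - (1 - s)^2) / s] tends to 2. *)
Lemma harnack_gap_cvg f z u : holomorphic f -> Hn z ->
  (forall j, normc (u 0 j) <= 1) ->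
  harnack_gap f z u k @[k --> \oo] --> 2 * (complex.Im (ext f z)
    - \sum_j complex.Im (z 0 j) * complex.Re (u 0 j * partial f j z)).
Proof.
move=> hf Hz u1; set S := \sum_j _; set y := complex.Im (ext f z).
have F0 := is_derive_ext_moebius0 hf Hz u1.
pose F b := ext f (moebius_disc z u b).
have F0' : is_derive (0 + (0 : R)%:C * -1 : R[i]) 1 F
    ('i%C * (2 * \sum_j (complex.Im (z 0 j))%:C * u 0 j * partial f j z)).
  by rewrite mul0r addr0.
have [_] := is_derive_slice F0'.
have -> : complex.Im ('i%C * (2 * \sum_j (complex.Im (z 0 j))%:C * u 0 j * partial f j z) * -1)
   = - (2 * S).
  rewrite mulrN1 ImN Im_i2M raddf_sum.
  congr (- (2 * _)); apply: eq_bigr => j _; rewrite -mulrA.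
  by case: (u 0 j * _) => a b /=; rewrite mul0r subr0.
move=> dI; apply/cvgrPdist_le => e e0.
have [de de0 H] := is_derive_dist dI (divr_gt0 e0 (ltr0n _ 2)).
have h1 : k.+2%:R^-1 @[k --> \oo] --> (0 : R).
  rewrite (cvg_shiftS (fun k => k.+1%:R^-1 : R)).
  exact: cvg_harmonic.
have /cvgrPdist_lt/(_ _ de0) N1 := h1.
have y0 : 0 < 1 + y by rewrite addr_gt0// ext_halfplane.
have /cvgrPdist_lt/(_ _ (divr_gt0 (divr_gt0 e0 (ltr0n _ 2)) y0)) N2 := h1.
apply: filterS2 N1 N2 => k N1 N2; rewrite /harnack_gap; set x : R := k.+2%:R^-1.
have x0 : 0 < x by rewrite invr_gt0.
have xde : `|x - 0| < de by rewrite distrC.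
have xy : x * (1 + y) <= e / 2.
  rewrite -ler_pdivlMr//; by move: N2; rewrite sub0r normrN gtr0_norm// => /ltW.
have := H x xde; rewrite /F !mul0r addr0 add0r mulrN1 moebius_disc0 subr0 (gtr0_norm x0) -/y.
set yx := complex.Im _ => Hx.
have -> : 2 * (y - S) - k.+2%:R * (yx - (1 - x) ^+ 2 * y) =
   x * y - (yx - y - - (2 * S) * x) / x.
  rewrite (_ : k.+2%:R = x^-1); last by rewrite invrK.
  by field; exact: lt0r_neq0.
apply: le_trans (ler_normB _ _) _; rewrite (splitr e); apply: lerD.
  rewrite ger0_norm; last by rewrite mulr_ge0 ?ltW// ext_halfplane.
  by apply: le_trans xy; rewrite ler_pM2l// lerDr.
by rewrite normrM normfV (gtr0_norm x0) ler_pdivrMr.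
Qed.

(** Compared with [schwarz_pick] for the optimal phases [v], equality makes a sum of nonnegative
    differences vanish, hence each of them. As [Im(z_j) > 0], the real part of [u_j d_j f(z)] equals
    its modulus. *)
Lemma schwarz_pick_phase f z u : holomorphic f -> Hn z -> (forall j, normc (u 0 j) = 1) ->
  \sum_j complex.Im (z 0 j) * complex.Re (u 0 j * partial f j z) = complex.Im (ext f z) ->
  forall j, u 0 j * partial f j z = (normc (partial f j z))%:C.
Proof.
move=> hf Hz u1 eqf.
have /choice[v vP] (j : 'I_n) : exists c, normc c = 1 /\ c * partial f j z = (normc (partial f j z))%:C.
  by have [v] := rotation (partial f j z); exists v.
have v1 j : normc ((\row_j v j : 'rV[R[i]]_n) 0 j) <= 1 by rewrite mxE (vP j).1.
have := schwarz_pick hf Hz v1; rewrite -eqf -subr_ge0 -sumrB => S0.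
have term j : 0 <= complex.Im (z 0 j) * normc (partial f j z)
    - complex.Im (z 0 j) * complex.Re (u 0 j * partial f j z).
  rewrite -mulrBr mulr_ge0 ?(ltW (Hz j))// subr_ge0.
  apply: le_trans (ler_norm _) _; apply: le_trans (normc_ge_Re _) _.
  by rewrite normcM u1 mul1r.
move=> j.
have : \sum_j (complex.Im (z 0 j) * normc (partial f j z)
    - complex.Im (z 0 j) * complex.Re (u 0 j * partial f j z)) = 0.
  apply/eqP; rewrite eq_le sumr_ge0// andbT -oppr_ge0 -sumrN.
  apply: le_trans S0 _; rewrite le_eqVlt; apply/orP; left; apply/eqP/eq_bigr => k _.
  by rewrite opprB mxE (vP k).2.
move=> /eqP; rewrite psumr_eq0// => /allP/(_ j (mem_index_enum j))/eqP.
rewrite -mulrBr => /eqP; rewrite mulf_eq0 gt_eqF ?(Hz j)//= subr_eq0 => /eqP E.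
have : normc (u 0 j * partial f j z) = normc (partial f j z) by rewrite normcM u1 mul1r.
rewrite E; move: (u 0 j * _) => [a b] /= h; apply/eqP; rewrite eq_complex /=.
have a0 : 0 <= a by rewrite -h sqrtr_ge0.
have : a ^+ 2 + b ^+ 2 = a ^+ 2.
  by rewrite -{2}h sqr_sqrtr// addr_ge0 ?sqr_ge0.
move=> /eqP; rewrite -subr_eq0 addrC addrA addNr add0r sqrf_eq0 => ->.
by rewrite eqxx.
Qed.

Lemma polydisc_center z r : 0 < r -> polydisc z r z.
Proof. by move=> r0 j; rewrite subrr ComplexField.Normc.normc0. Qed.

Lemma polydiscW z r s : r <= s -> polydisc z r `<=` polydisc z s.
Proof. by move=> rs w H j; apply: lt_le_trans (H j) rs. Qed.

Lemma polydiscD z w v r s : polydisc z r w -> (forall j, normc (v 0 j) < s) ->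
  polydisc z (r + s) (w + v).
Proof.
move=> H V j; rewrite mxE addrAC; apply: le_lt_trans (ler_normcD _ _) _.
exact: ltrD.
Qed.

Lemma ext_continuous f z e : holomorphic f -> Hn z -> 0 < e ->
  exists2 r, 0 < r & forall w, polydisc z r w -> normc (ext f w - ext f z) < e.
Proof.
move=> hf Hz e0; have /cvgrPdist_lt cf := differentiable_continuous (hf z Hz).
have e0' : 0 < e%:C by rewrite ltcR.
have [r r0 H] := nbhs_polydisc (cf _ e0').
by exists r => // w /H; rewrite normC ltcR normcBC.
Qed.

Lemma ext_locally_bounded f z : holomorphic f -> Hn z ->
  exists r (M : R), [/\ 0 < r, polydisc z r `<=` Hn &
    forall w, polydisc z r w -> normc (ext f w) <= M].
Proof.
move=> hf Hz; have [r r0 H] := ext_continuous hf Hz ltr01.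
have nH : nbhs z Hn by apply: open_nbhs_nbhs; split => //; exact: open_polyhalfplane.
have [s s0 sH] := nbhs_polydisc nH.
exists (Num.min r s), (1 + normc (ext f z)); split.
- by rewrite lt_min r0.
- by apply: subset_trans sH; apply: polydiscW; rewrite ge_min lexx orbT.
- move=> w wz; have {}H : normc (ext f w - ext f z) < 1.
    by apply: H; apply: polydiscW wz; rewrite ge_min lexx.
  rewrite -(subrK (ext f z) (ext f w)); apply: le_trans (ler_normcD _ _) _.
  by rewrite lerD2r ltW.
Qed.

Lemma normc_delta_le1 (j k : 'I_n) : normc ((delta_mx 0 j : 'rV[R[i]]_n) 0 k) <= 1.
Proof.
rewrite mxE eqxx; case: (k == j).
  by rewrite ComplexField.Normc.normc1.
by rewrite ComplexField.Normc.normc0.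
Qed.

(** Both Cauchy estimates on the disc of radius [r / 2] around [w] in the direction [j], which stays
    in the polydisc of radius [r]. Replacing [rad] by [r / 2] explains the constants 4, 256 and
    8. *)
Lemma partial_estimate f z r (M : R) w (j : 'I_n) (h : R[i]) : holomorphic f -> 0 < r ->
  polydisc z r `<=` Hn -> (forall w, polydisc z r w -> normc (ext f w) <= M) ->
  polydisc z (r / 2) w -> normc h < r / 8 ->
  r * normc (partial f j w) <= 4 * M /\
  normc (ext f (w + h *: delta_mx 0 j) - ext f w - partial f j w * h)
    <= 256 * M / r ^+ 2 * normc h ^+ 2.
Proof.
move=> hf r0 rH rM wz hr.
have r20 : 0 < r / 2 by rewrite divr_gt0.
have inP a : normc a < r / 2 -> polydisc z r (w + a *: delta_mx 0 j).
  move=> ar; rewrite (splitr r); apply: polydiscD => // k.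
  rewrite mxE normcM; apply: le_lt_trans ar.
  by rewrite ler_piMr ?normc_ge0// normc_delta_le1.
pose dF a := partial f j (w + a *: delta_mx 0 j).
have dK a : normc (a - 0) < r / 2 ->
    is_derive a 1 (fun b => ext f (w + b *: delta_mx 0 j)) (dF a).
  rewrite subr0 => /inP/rH Ha; have := is_derive_ext_line hf Ha.
  congr is_derive; rewrite (bigD1 j)//= big1 => [|k kj]; rewrite mxE ?eqxx ?mul1r ?addr0//.
  by rewrite (negbTE kj) mul0r.
have KM a : normc (a - 0) < r / 2 -> normc (ext f (w + a *: delta_mx 0 j)) <= M.
  by rewrite subr0 => /inP/rM.
have w0 : w + 0 *: delta_mx 0 j = w by rewrite scale0r addr0.
have zz : normc (0 - 0 : R[i]) < r / 2 by rewrite subrr ComplexField.Normc.normc0.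
split.
  have := @cauchy_estimate _ (fun b => ext f (w + b *: delta_mx 0 j)) 0 (dF 0) (r / 2) M r20 _ (dK 0 zz) KM.
  rewrite /dF w0 => H; suff : r / 2 * normc (partial f j w) <= 2 * M by lra.
  by apply: H => a /dK[].
have := @cauchy_estimate2 _ (fun b => ext f (w + b *: delta_mx 0 j)) 0 (r / 2) M h dF r20 dK KM.
rewrite add0r w0 /dF w0 => H; apply: le_trans (H _) _.
  by rewrite -mulrA -invfM -natrM.
rewrite le_eqVlt; apply/orP; left; apply/eqP; field; exact: lt0r_neq0.
Qed.

Lemma four_point (K : comPzRingType) (p q t a b c d : K) :
  (p - q) * t = (a - b - q * t) - (c - d - p * t) + ((c - a) - (d - b)).
Proof. ring. Qed.

(** Near [z] the partial derivative is uniformly within [C * t] of the difference quotient with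
    fixed step [t], which is continuous because [f] is. [four_point] splits the increment
    accordingly. *)
Lemma partial_continuous f z (j : 'I_n) e : holomorphic f -> Hn z -> 0 < e ->
  exists2 r, 0 < r & forall w, polydisc z r w ->
    normc (partial f j w - partial f j z) <= e.
Proof.
move=> hf Hz e0; have [r [M [r0 rH rM]]] := ext_locally_bounded hf Hz.
pose C := 256 * M / r ^+ 2.
have M0 : 0 <= M by apply: le_trans (normc_ge0 _) (rM z (polydisc_center z r0)).
have C0 : 0 <= C by apply: divr_ge0; [exact: mulr_ge0|exact: sqr_ge0].
(* The first bound gives the strict [t < r / 8]; the second makes the two Taylor remainders at most
   [e * t / 4] each, like the two continuity errors. *)
pose t := Num.min (r / 16) (e / (4 * (C + 1))).
have C1 : 0 < 4 * (C + 1) by rewrite mulr_gt0// ltr_wpDl.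
have t0 : 0 < t by rewrite lt_min !divr_gt0.
have tr : t < r / 8.
  apply: (@le_lt_trans _ _ (r / 16)); first by rewrite ge_min lexx.
  by rewrite ltr_pM2l// ltf_pV2 ?posrE// ltr_nat.
have te : 4 * (C * t) <= e.
  have : t <= e / (4 * (C + 1)) by rewrite ge_min lexx orbT.
  rewrite ler_pdivlMr// => h; apply: le_trans h; nra.
pose v : 'rV[R[i]]_n := t%:C *: delta_mx 0 j.
have nt : normc t%:C = t by rewrite normcR gtr0_norm.
have est w : polydisc z (r / 2) w -> normc (ext f (w + v) - ext f w - partial f j w * t%:C)
    <= C * t ^+ 2.
  by move=> wz; have := @partial_estimate f z r M w j t%:C hf r0 rH rM wz; rewrite nt => /(_ tr)[].
have Hv : Hn (z + v).
  apply: rH => k; have -> : (z + v) 0 k - z 0 k = t%:C * (delta_mx 0 j : 'rV[R[i]]_n) 0 k.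
    by rewrite mxE addrAC subrr add0r mxE.
  rewrite normcM nt; apply: (@le_lt_trans _ _ t).
    by rewrite ler_piMr ?(ltW t0)// normc_delta_le1.
  by apply: lt_trans tr _; rewrite ltr_pdivrMr// ltr_pMr// ltr1n.
have et0 : 0 < e * t / 4 by rewrite divr_gt0// mulr_gt0.
have [r1 r10 H1] := ext_continuous hf Hz et0.
have [r2 r20 H2] := ext_continuous hf Hv et0.
exists (Num.min (r / 2) (Num.min r1 r2)); first by rewrite !lt_min r10 r20 divr_gt0.
move=> w wz; have wz0 : polydisc z (r / 2) w by apply: polydiscW wz; rewrite ge_min lexx.
have {}H1 : normc (ext f w - ext f z) < e * t / 4.
  by apply: H1; apply: polydiscW wz; rewrite !ge_min lexx ?orbT.
have {}H2 : normc (ext f (w + v) - ext f (z + v)) < e * t / 4.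
  apply: H2 => k; have := wz k; rewrite !lt_min => /and3P[_ _].
  by rewrite !mxE opprD addrACA subrr addr0.
have E1 := est w wz0; have E2 := est z (polydisc_center z (divr_gt0 r0 (ltr0n _ 2))).
rewrite -(@ler_pM2r _ t)// -{1}nt -normcM.
rewrite (@four_point _ (partial f j w) (partial f j z) t%:C (ext f (z + v)) (ext f z)
  (ext f (w + v)) (ext f w)).
apply: le_trans (ler_normcD _ _) _.
apply: le_trans (lerD (ler_normcB _ _) (ler_normcB _ _)) _.
apply: le_trans (lerD (lerD E2 E1) (lerD (ltW H2) (ltW H1))) _.
have : 4 * (C * t ^+ 2) <= e * t by rewrite expr2 mulrA mulrA -[4 * C * t]mulrA ler_pM2r.
by move: (C * t ^+ 2) (e * t) => x y; clear; lra.
Qed.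

Lemma ratio_conj_real a b : b != 0 -> complex.Im (a * b^*) = 0 -> complex.Im (a / b) = 0.
Proof.
move=> b0 H; have nb : normc b != 0 by rewrite normc_eq0.
rewrite invc_norm normC -rmorphXn/= -rmorphV/= ?unitfE ?expf_neq0// mulrCA.
by move: H; case: (a * _) => x y /= ->; rewrite mulr0 mul0r addr0.
Qed.

(** The terms in [t] cancel; inserting them exposes the first-order remainders of the increments [a]
    and [b]. *)
Lemma quotient_estimate (p q a b t : R[i]) : q != 0 -> b != 0 ->
  a / b - p / q = ((a - p * t) * q - p * (b - q * t)) / (b * q).
Proof. by move=> q0 b0; field; apply/andP. Qed.

Lemma half_lower r s e : e <= r + s -> s <= e / 2 -> e / 2 <= r.
Proof. lra. Qed.

Lemma quarter_lower r s x : x * 2 <= r + s -> s <= x -> x <= r.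
Proof. lra. Qed.

Lemma le_mul_div r s x : 0 < r -> r * x <= s -> x <= s / r.
Proof. by move=> r0; rewrite ler_pdivlMr// mulrC. Qed.

Lemma quotient_bound (B C m d i : R) : 0 < i -> i * (16 * B * C + 1) < d * m ^+ 2 ->
  C * i ^+ 2 * B + B * (C * i ^+ 2) <= d * ((i * m / 4) * (m / 2)).
Proof.
move=> i0 h; have : i * (i * (16 * B * C + 1)) <= i * (d * m ^+ 2) by rewrite ler_pM2l// ltW.
have := sqr_ge0 i; lra.
Qed.

Lemma ratio_eq1 a b : a = b -> b != 0 -> a / b = 1.
Proof. by move=> -> b0; rewrite divff. Qed.

Lemma eq_of_ratio a b : b != 0 -> a / b = 1 -> a = b.
Proof. by move=> b0 E; rewrite -[LHS](divfK b0) E mul1r. Qed.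

Lemma near_center z v r a : 0 < r -> (forall k, normc (v 0 k) < r / 4) -> normc a < 2 ->
  polydisc z (r / 2) (z + a *: v).
Proof.
move=> r0 vr a2 k; rewrite mxE addrAC subrr add0r mxE normcM.
apply: (@le_lt_trans _ _ (2 * normc (v 0 k))).
  by rewrite ler_wpM2r ?normc_ge0// ltW.
by have := vr k; rewrite ltr_pdivlMr//; lra.
Qed.

(* Along [z + a v], the ratio of partial derivatives is the limit as [i -> 0] of the
   holomorphic quotients of increments in direction [i e_j], so that
   [real_limit_constant] applies without differentiating the partial derivatives. *)
Lemma partial_ratio_constant f g z (j : 'I_n) : holomorphic f -> holomorphic g -> Hn z ->
  (forall w, Hn w -> complex.Im (partial f j w * (partial g j w)^*) = 0) ->
  partial f j z = partial g j z -> partial g j z != 0 ->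
  exists2 r, 0 < r & forall v, (forall k, normc (v 0 k) < r) ->
    partial f j (z + v) = partial g j (z + v).
Proof.
move=> hf hg Hz fg fgz gz0; pose m := normc (partial g j z).
have m0 : 0 < m by rewrite normc_gt0.
have [rf [Mf [rf0 rfH fM]]] := ext_locally_bounded hf Hz.
have [rg [Mg [rg0 rgH gM]]] := ext_locally_bounded hg Hz.
have [rc rc0 gc] := partial_continuous j hg Hz (divr_gt0 m0 (ltr0n _ 2)).
pose r : R := Num.min rf rg; pose M : R := Num.max Mf Mg.
have r0 : 0 < r by rewrite lt_min rf0.
have rH : polydisc z r `<=` Hn by apply: subset_trans rfH; apply: polydiscW; rewrite ge_min lexx.
have {}fM w : polydisc z r w -> normc (ext f w) <= M.
  by move=> wz; rewrite le_max fM//; apply: polydiscW wz; rewrite ge_min lexx.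
have {}gM w : polydisc z r w -> normc (ext g w) <= M.
  by move=> wz; rewrite le_max gM ?orbT//; apply: polydiscW wz; rewrite ge_min lexx orbT.
have M0 : 0 <= M by apply: le_trans (normc_ge0 _) (fM z (polydisc_center z r0)).
pose C : R := 256 * M / r ^+ 2; pose B : R := 4 * M / r.
have C0 : 0 <= C by apply: divr_ge0; [exact: mulr_ge0|exact: sqr_ge0].
have B0 : 0 <= B by rewrite divr_ge0 ?(ltW r0)// mulr_ge0.
pose s : R := Num.min r rc; have s0 : 0 < s by rewrite lt_min r0.
have q0 w : polydisc z (s / 2) w -> m / 2 <= normc (partial g j w).
  move=> ws; have := gc w _; move=> H.
  have {}H : normc (partial g j w - partial g j z) <= m / 2.
    apply: H; apply: polydiscW ws; rewrite ler_pdivrMr//.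
    by apply: (@le_trans _ _ rc); rewrite ?ge_min ?lexx ?orbT// ler_peMr ?(ltW rc0)// ler1n.
  have := ler_normcB (partial g j w) (partial g j w - partial g j z).
  by rewrite subKr => H'; exact: half_lower H' H.
have sr w : polydisc z (s / 2) w -> polydisc z (r / 2) w.
  by apply: polydiscW; rewrite ler_pM2r// ge_min lexx.
(* [r / 8] is the range of [partial_estimate]. The second bound gives [C * i <= m / 4], so that the
   increment of [g] is at least [i * m / 2 - C * i^2 >= i * m / 4] in modulus. *)
pose i0 : R := Num.min (r / 8) (m / (4 * C + 1)).
have k0 : 0 < 4 * C + 1 by rewrite ltr_wpDl// mulr_ge0.
have i00 : 0 < i0 by rewrite lt_min !divr_gt0.
pose e i : 'rV[R[i]]_n := (i : R)%:C *: delta_mx 0 j.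
pose Df i w := ext f (w + e i) - ext f w; pose Dg i w := ext g (w + e i) - ext g w.
have small i : 0 < i < i0 -> [/\ 0 < i, normc i%:C = i, i < r / 8 & C * i <= m / 4].
  move=> /andP[i_0]; rewrite lt_min => /andP[ir im]; split => //.
    by rewrite normcR gtr0_norm.
  move: im; rewrite ltr_pdivlMr// => im.
  by rewrite ler_pdivlMr// -mulrA mulrC -mulrA; apply: le_trans (ltW im); rewrite ler_wpM2l ?(ltW i_0)// lerDl.
have est i w : 0 < i < i0 -> polydisc z (s / 2) w ->
   [/\ normc (partial f j w) <= B, normc (partial g j w) <= B,
     normc (Df i w - partial f j w * i%:C) <= C * i ^+ 2 &
     normc (Dg i w - partial g j w * i%:C) <= C * i ^+ 2].
  move=> /small[i_0 ni ir _] /sr ws; rewrite -ni in ir.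
  have [f1 f2] := partial_estimate j hf r0 rH fM ws ir.
  have [g1 g2] := partial_estimate j hg r0 rH gM ws ir.
  rewrite ni in f2; rewrite ni in g2; split; last 1 first.
  - exact: g2.
  - exact: le_mul_div f1.
  - exact: le_mul_div g1.
  - exact: f2.
have lowDg i w : 0 < i < i0 -> polydisc z (s / 2) w -> i * m / 4 <= normc (Dg i w).
  move=> iI ws; have [_ _ _ g2] := est i w iI ws; have [i_0 ni _ iC] := small i iI.
  have := ler_normcB (Dg i w) (Dg i w - partial g j w * i%:C).
  rewrite subKr normcM ni => h.
  have h1 := q0 w ws.
  have h2 : i * (m / 2) <= i * normc (partial g j w) by rewrite ler_pM2l.
  have h3 : i * (C * i) <= i * (m / 4) by rewrite ler_pM2l.
  have h4 : normc (Dg i w - partial g j w * i%:C) <= i * m / 4.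
    by apply: le_trans g2 _; rewrite expr2 mulrA mulrC -mulrA.
  apply: (quarter_lower (s := normc (Dg i w - partial g j w * i%:C))) h4.
  by apply: le_trans h; rewrite [X in _ <= X]mulrC; apply: le_trans h2; rewrite le_eqVlt; apply/orP; left; apply/eqP; field.
have uppDf i w : 0 < i < i0 -> polydisc z (s / 2) w -> normc (Df i w) <= i * (B + m / 4).
  move=> iI ws; have [f1 _ f2 _] := est i w iI ws; have [i_0 ni _ iC] := small i iI.
  rewrite -(subrK (partial f j w * i%:C) (Df i w)).
  apply: le_trans (ler_normcD _ _) _; rewrite normcM ni mulrDr addrC lerD//.
    by rewrite mulrC ler_pM2l.
  by apply: le_trans f2 _; rewrite expr2 mulrA mulrC ler_pM2l.
have Dg0 i w : 0 < i < i0 -> polydisc z (s / 2) w -> Dg i w != 0.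
  move=> iI ws; rewrite -normc_gt0; apply: lt_le_trans (lowDg i w iI ws).
  by have [i_0 _ _ _] := small i iI; rewrite divr_gt0// mulr_gt0.
have g0 w : polydisc z (s / 2) w -> partial g j w != 0.
  by move=> ws; rewrite -normc_gt0; apply: lt_le_trans (q0 w ws); rewrite divr_gt0.
(* [real_limit_constant] lets [a] range over |a| < 2, and [z + a v] must stay in the polydisc of
   radius [s / 2]. *)
exists (s / 4) => [|v vs]; first by rewrite divr_gt0.
have inP a : normc a < 2 -> polydisc z (s / 2) (z + a *: v).
  by move=> a2; exact: near_center.
pose ai i a := Df i (z + a *: v) / Dg i (z + a *: v).
pose al a := partial f j (z + a *: v) / partial g j (z + a *: v).
have Hline i a : 0 < i < i0 -> normc a < 2 -> Hn (z + e i + a *: v).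
  move=> iI /inP/sr ws; have [i_0 ni ir _] := small i iI.
  rewrite addrAC; apply: rH; rewrite (splitr r); apply: polydiscD => // k.
  rewrite mxE normcM ni; apply: (@le_lt_trans _ _ i).
    by rewrite ler_piMr ?(ltW i_0)// normc_delta_le1.
  by apply: lt_trans ir _; rewrite ltr_pM2l// ltf_pV2 ?posrE// ltr_nat.
have Hline0 a : normc a < 2 -> Hn (z + a *: v).
  move=> /inP/sr ws; apply: rH; apply: polydiscW ws.
  by rewrite ler_pdivrMr// ler_peMr ?(ltW r0)// ler1n.
have dD h i a : holomorphic h -> 0 < i < i0 -> normc a < 2 ->
    derivable (fun a => ext h (z + a *: v + e i) - ext h (z + a *: v)) a 1.
  move=> hh iI a2; apply: derivableB.
    have [] := is_derive_ext_line hh (Hline i a iI a2).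
    have -> : (fun b => ext h (z + e i + b *: v)) = (fun a => ext h (z + a *: v + e i)).
      by apply/funext => b; rewrite addrAC.
    by [].
  by have [] := is_derive_ext_line hh (Hline0 a a2).
have := @real_limit_constant _ ai al ((B + m / 4) * (4 / m)) i0 i00.
move=> /(_ _ _ _ _)/wrap[].
- move=> i a iI a2; apply: derivable_quotient; [exact: dD|exact: dD|].
  exact: Dg0 (inP a a2).
- move=> i a iI a2; have [i_0 _ _ _] := small i iI.
  rewrite normcM normcV; have n0 := Dg0 i _ iI (inP a a2).
  rewrite ler_pdivrMr ?normc_gt0//; apply: le_trans (uppDf i _ iI (inP a a2)) _.
  have -> : i * (B + m / 4) = (B + m / 4) * (4 / m) * (i * m / 4).
    by field; exact: lt0r_neq0.
  rewrite ler_wpM2l ?lowDg//; last exact: inP.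
  by rewrite mulr_ge0// ?divr_ge0 ?(ltW m0)// addr_ge0// divr_ge0// ltW.
- move=> a a2 d d0; have k1 : 0 < 16 * B * C + 1.
    by rewrite ltr_wpDl// mulr_ge0// mulr_ge0.
  (* In [quotient_estimate] the numerator is at most [2 * B * C * i^2] and the denominator at least
     [i * m^2 / 8]. *)
  exists (Num.min i0 (d * m ^+ 2 / (16 * B * C + 1))).
    by rewrite lt_min i00 divr_gt0// mulr_gt0// exprn_gt0.
  move=> i /andP[i_0]; rewrite lt_min ltr_pdivlMr// => /andP[ii0 id].
  have iI : 0 < i < i0 by rewrite i_0.
  have ws := inP a a2; have [f1 g1 f2 g2] := est i _ iI ws.
  rewrite (quotient_estimate _ _ i%:C (g0 _ ws) (Dg0 i _ iI ws)) normcM normcV normcM.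
  rewrite ler_pdivrMr; last by rewrite mulr_gt0 ?normc_gt0 ?g0 ?Dg0.
  apply: le_trans (ler_normcB _ _) _; rewrite !normcM.
  apply: (@le_trans _ _ (C * i ^+ 2 * B + B * (C * i ^+ 2))).
    exact: (lerD (ler_pM (normc_ge0 _) (normc_ge0 _) f2 g1)
                 (ler_pM (normc_ge0 _) (normc_ge0 _) f1 g2)).
  apply: (@le_trans _ _ (d * ((i * m / 4) * (m / 2)))).
    exact: quotient_bound.
  rewrite ler_pM2l//; apply: ler_pM; [| |exact: lowDg|exact: q0].
    by rewrite divr_ge0// mulr_ge0 ?(ltW i_0)// ltW.
  by rewrite divr_ge0// ltW.
- move=> a a2; apply: ratio_conj_real; first exact/g0/inP.
  exact/fg/Hline0.
have z1 : z + 1 *: v = z + v by rewrite scale1r.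
have z0 : z + 0 *: v = z by rewrite scale0r addr0.
have n0 : partial g j (z + v) != 0.
  by rewrite -z1; apply/g0/inP; rewrite ComplexField.Normc.normc1 ltr1n.
have al1 : al 1 = _ := congr1 (fun w => partial f j w / partial g j w) z1.
have al0 : al 0 = _ := congr1 (fun w => partial f j w / partial g j w) z0.
move=> E; apply: (eq_of_ratio n0); apply: etrans (esym al1) _; apply: etrans E _.
exact: etrans al0 (ratio_eq1 fgz gz0).
Qed.

End several_variables.

Lemma derivable_cayley (K : numFieldType) (F : K -> K) (k a : K) : derivable F a 1 ->
  F a + k != 0 -> derivable (fun b => (F b - k) / (F b + k)) a 1.
Proof.
move=> dF n0; apply: derivable_quotient; last exact: n0.
  by apply: derivableB; [exact: dF|exact: derivable_cst].
by apply: derivableD; [exact: dF|exact: derivable_cst].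
Qed.

(** * From equal derivatives to equality near a point, and the identity theorem *)

Section identity.
Context {R : realType} {n : nat}.
Implicit Types (f : maps R n) (z w u v : 'rV[R[i]]_n) (a b c : R[i]) (e r s : R).
Local Notation Hn := (polyhalfplane R n).

Lemma uniform_radius (P : 'I_n -> R -> Prop) :
  (forall j r s, s <= r -> P j r -> P j s) ->
  (forall j, exists2 r, 0 < r & P j r) -> exists2 r, 0 < r & forall j, P j r.
Proof.
move=> mono ex; have /choice[r rP] j : exists r, 0 < r /\ P j r.
  by have [r] := ex j; exists r.
exists (\big[Num.min/1]_j r j) => [|j].
  by apply/bigmin_gtP; split => // j _; exact: (rP j).1.
by apply: mono (rP j).2; exact: bigmin_le.
Qed.

(** All partial derivatives agree near [z], so [f - g] has derivative zero along each short segment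
    from [z]. *)
Lemma eq_near_center f g z : holomorphic f -> holomorphic g -> Hn z ->
  (forall j w, Hn w -> complex.Im (partial f j w * (partial g j w)^*) = 0) ->
  (forall j, partial f j z = partial g j z) -> (forall j, partial g j z != 0) ->
  ext f z = ext g z ->
  exists2 r, 0 < r & forall w, polydisc z r w -> ext f w = ext g w.
Proof.
move=> hf hg Hz fg fgz gz0 E.
have [r r0 rP] := @uniform_radius (fun j r => forall v, (forall k, normc (v 0 k) < r) ->
    partial f j (z + v) = partial g j (z + v))
  (fun j r s sr H v vs => H v (fun k => lt_le_trans (vs k) sr))
  (fun j => partial_ratio_constant hf hg Hz (fg j) (fgz j) (gz0 j)).
have nH : nbhs z Hn by apply: open_nbhs_nbhs; split => //; exact: open_polyhalfplane.
have [s s0 sH] := nbhs_polydisc nH.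
exists (Num.min r s) => [|w wz]; first by rewrite lt_min r0.
pose v := w - z; have vr k : normc (v 0 k) < Num.min r s by have := wz k; rewrite !mxE.
have xv (x : R) k : 0 <= x <= 1 -> normc ((x%:C *: v) 0 k) <= normc (v 0 k).
  move=> /andP[x0 x1]; rewrite mxE normcM normcR ger0_norm// ler_piMl ?normc_ge0//.
pose F a := ext f (z + a *: v) - ext g (z + a *: v).
pose dF a := (\sum_j v 0 j * partial f j (z + a *: v)) - (\sum_j v 0 j * partial g j (z + a *: v)).
have Hx (x : R) : 0 <= x <= 1 -> Hn (z + x%:C *: v).
  move=> xI; apply: sH => k.
  have -> : (z + x%:C *: v) 0 k - z 0 k = (x%:C *: v) 0 k by rewrite mxE addrAC subrr add0r.
  by apply: le_lt_trans (xv _ _ xI) _; have := vr k; rewrite lt_min => /andP[].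
have dFP (x : R) : 0 <= x <= 1 -> is_derive (0 + x%:C * 1) 1 F (dF (0 + x%:C * 1)).
  move=> xI; rewrite add0r mulr1; apply: is_deriveB.
    exact: is_derive_ext_line hf (Hx x xI).
  exact: is_derive_ext_line hg (Hx x xI).
have dFE (x : R) : 0 <= x <= 1 -> dF x%:C = 0.
  move=> xI; apply/eqP; rewrite subr_eq0; apply/eqP; apply: eq_bigr => j _.
  have xvr k : normc ((x%:C *: v) 0 k) < r.
    by apply: le_lt_trans (xv _ _ xI) _; have := vr k; rewrite lt_min => /andP[].
  exact: (congr1 ( *%R (v 0 j)) (rP j (x%:C *: v) xvr)).
have dF0 (x : R) : 0 <= x <= 1 -> normc (dF (0 + x%:C * 1)) <= 0.
  by move=> xI; rewrite add0r mulr1 (dFE x xI) ComplexField.Normc.normc0.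
have := mean_value_le dFP dF0; rewrite mul0r => N.
have F0 : F 0 = 0 by rewrite /F scale0r addr0 E subrr.
have vz : z + 1 *: v = w by rewrite scale1r /v addrC subrK.
have F1 : F 1 = _ := congr1 (fun w => ext f w - ext g w) vz.
have := N; rewrite add0r F0 subr0 F1 => {}N.
apply/eqP; rewrite -subr_eq0 -normc_eq0 eq_le N normc_ge0 //.
Qed.

Lemma cayley_norm a : 0 < complex.Im a -> a + 'i%C != 0 /\ normc ((a - 'i%C) / (a + 'i%C)) < 1.
Proof.
move=> a0; have n0 : a + 'i%C != 0.
  case: a a0 => x y /= y0.
  by rewrite eq_complex /= negb_and; apply/orP; right; rewrite gt_eqF// addr_gt0.
split; first exact: n0.
rewrite normcM normcV ltr_pdivrMr ?normc_gt0// mul1r.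
case: a a0 {n0} => x y /= y0; rewrite ltr_sqrt.
  by rewrite subr0 addr0 ltrD2l; nra.
by rewrite ltr_wpDl ?sqr_ge0// exprn_gt0// addr_gt0.
Qed.

Lemma cayley_inj a b : a + 'i%C != 0 -> b + 'i%C != 0 ->
  (a - 'i%C) / (a + 'i%C) - (b - 'i%C) / (b + 'i%C) = 0 -> a = b.
Proof.
move=> a0 b0 /eqP; rewrite subr_eq0 eqr_div// => /eqP E.
have : 2 * 'i%C * (a - b) = 0.
  have -> : 2 * 'i%C * (a - b) = (a - 'i%C) * (b + 'i%C) - (b - 'i%C) * (a + 'i%C).
    by ring.
  by rewrite E subrr.
move=> /eqP; rewrite !mulf_eq0 pnatr_eq0/= subr_eq0 => /orP[|/eqP//].
by rewrite eq_complex /= oner_eq0 andbF.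
Qed.

Lemma conj_i : Num.conj 'i%C = - 'i%C :> R[i].
Proof. by apply/eqP; rewrite eq_complex /= oppr0 !eqxx. Qed.

(** Each [z] lies on a disc [moebius_disc] centred at [(i, ..., i)]: its direction is given by the
    Cayley transforms of the coordinates of [z]. After a Cayley transform of the values, the
    difference of [f] and [g] on this disc is bounded and [disc_identity] applies. *)
Lemma identity_polyhalfplane f g r : holomorphic f -> holomorphic g -> 0 < r ->
  (forall w, polydisc (const_mx 'i%C) r w -> ext f w = ext g w) ->
  forall z, Hn z -> ext f z = ext g z.
Proof.
move=> hf hg r0 fg z Hz; pose c : 'rV[R[i]]_n := const_mx 'i%C.
have Hc : Hn c by move=> j; rewrite /halfplane /= mxE /=.
pose w j := (z 0 j - 'i%C) / (z 0 j + 'i%C).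
have w1 j : normc (w j) < 1 by exact: (cayley_norm (Hz j)).2.
(* The default [1 / 2] keeps [t] positive, hence invertible, even when all [w j] vanish. *)
pose t : R := \big[Num.max/2^-1]_j normc (w j).
have t1 : t < 1.
  by apply/bigmax_ltP; split => // ; rewrite invf_lt1// ltr1n.
have t2 : 2^-1 <= t by exact: bigmax_ge_id.
have t0 : 0 < t by apply: lt_le_trans t2; rewrite invr_gt0.
have wt j : normc (w j) <= t by exact: le_bigmax.
have nt : normc t%:C = t by rewrite normcR gtr0_norm.
have tC0 : t%:C != 0 by rewrite -normc_gt0 nt.
pose u : 'rV[R[i]]_n := \row_j (w j / t%:C).
have u1 j : normc (u 0 j) <= 1.
  by rewrite mxE normcM normcV nt ler_pdivrMr// mul1r.
have psit : moebius_disc c u t%:C = z.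
  apply/rowP => j; rewrite !mxE !mulNr -!mulrA mulVf// mulr1.
  have [n0 _] := cayley_norm (Hz j).
  rewrite conj_i.
  have i0 : 'i%C != 0 :> R[i] by rewrite eq_complex /= oner_eq0 andbF.
  rewrite mulNr opprK /w.
  have -> : 'i%C + 'i%C * ((z 0 j - 'i%C) / (z 0 j + 'i%C)) = (2 * 'i%C * z 0 j) / (z 0 j + 'i%C) by field.
  have -> : 1 - (z 0 j - 'i%C) / (z 0 j + 'i%C) = (2 * 'i%C) / (z 0 j + 'i%C) by field.
  by field; rewrite ?n0 ?i0.
pose K a := (ext f (moebius_disc c u a) - 'i%C) / (ext f (moebius_disc c u a) + 'i%C)
  - (ext g (moebius_disc c u a) - 'i%C) / (ext g (moebius_disc c u a) + 'i%C).
have Ha a : normc a < 1 -> Hn (moebius_disc c u a) by exact: moebius_disc_halfplane.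
have dK a : normc a < 1 -> derivable K a 1.
  move=> a1; apply: derivableB; apply: derivable_cayley.
  - exact: derivable_ext_moebius.
  - by have [] := cayley_norm (ext_halfplane f (Ha a a1)).
  - exact: derivable_ext_moebius.
  - by have [] := cayley_norm (ext_halfplane g (Ha a a1)).
have K2 a : normc a < 1 -> normc (K a) <= 2.
  move=> a1; apply: le_trans (ler_normcB _ _) _.
  have [_ /ltW h1] := cayley_norm (ext_halfplane f (Ha a a1)).
  have [_ /ltW h2] := cayley_norm (ext_halfplane g (Ha a a1)).
  by rewrite -[leRHS]/(1 + 1) lerD.
(* The distance from [i] to a coordinate of the disc at [a] is |2 U a / (1 - U a)|, which is at most
   4 |a| when |a| <= 1 / 2. *)
have e0 : 0 < Num.min (2^-1) (r / 4) by rewrite lt_min; apply/andP; split; [rewrite invr_gt0|apply: divr_gt0].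
have K0 a : normc a < Num.min (2^-1) (r / 4) -> K a = 0.
  rewrite lt_min => /andP[a2 ar]; rewrite /K fg ?subrr// => j; rewrite !mxE.
  have ua : normc (u 0 j * a) <= normc a by rewrite normcM ler_piMl ?normc_ge0.
  rewrite conj_i.
  have den : 2^-1 <= normc (1 + - u 0 j * a).
    have := ler_normcB (1 + - u 0 j * a) (- u 0 j * a).
    rewrite addrK ComplexField.Normc.normc1 mulNr normcN => h.
    by have := ltW a2; lra.
  have d0 : 1 + - u 0 j * a != 0 by rewrite -normc_gt0; apply: lt_le_trans den; rewrite invr_gt0.
  rewrite mxE in d0 den ua.
  set U := w j / t%:C in d0 den ua *.
  have -> : ('i%C + - (- 'i%C * U) * a) / (1 + - U * a) - 'i%C = 2 * 'i%C * (U * a) / (1 + - U * a).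
    by field.
  rewrite normcM normcV ltr_pdivrMr; last by rewrite normc_gt0.
  rewrite normcM.
  have -> : normc (2 * 'i%C : R[i]) = 2.
    by rewrite mulr_natl /= ; rewrite addr0 expr0n add0r sqrtr_sqr ger0_norm.
  have h1 : r * 2^-1 <= r * normc (1 + - U * a) by rewrite ler_pM2l.
  apply: lt_le_trans h1; apply: le_lt_trans (_ : 2 * normc a < _).
    by rewrite ler_pM2l.
  by move: ar; rewrite ltr_pdivlMr//; lra.
have := disc_identity e0 dK K2 K0 (p := t%:C); rewrite nt => /(_ t1).
rewrite /K psit; apply: cayley_inj.
  by have [] := cayley_norm (ext_halfplane f Hz).
by have [] := cayley_norm (ext_halfplane g Hz).
Qed.

End identity.

(** * The barycenter *)

Lemma continuous_translate (K : numFieldType) (c : K) : continuous (fun a : K => a - c).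
Proof.
move=> a; apply: (@cvgD K K K (nbhs a) _ id (fun=> - c) a (- c)) => //.
exact: cvg_cst.
Qed.

Section barycenter.
Context {R : realType} {n : nat}.
Implicit Types (f g : borelC R n.+1) (z w u : 'rV[R[i]]_n.+1) (x : R).
Local Notation Hn := (polyhalfplane R n.+1).

(** [Im f(z) > x] is a subbasic open condition of the compact-open topology, with the compact set
    [{z}]; such rays generate the Borel sets of the line. *)
Lemma measurable_Im_ext z : Hn z ->
  measurable_fun setT (fun f => complex.Im (ext (set_val f) z) : R).
Proof.
move=> Hz; apply: (measurability _ (RGenOInfty.measurableE R)) => //.
move=> /= _ [_ [x ->] <-]; rewrite setTI; apply: sub_sigma_algebra.
pose p : polyhalfplane R n.+1 := SigSub (mem_set Hz).
pose O : set (halfplane R) := [set a | x < complex.Im (set_val a)].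
have oO : open O.
  exists [set a : R[i] | x < complex.Im a] => //.
  have -> : [set a : R[i] | x < complex.Im a] = (fun a => a - (0 +i* x)) @^-1` (halfplane R).
    by apply/seteqP; split => a /=; rewrite /halfplane /=; case: a => a b /=; rewrite subr_gt0.
  apply: open_comp; last exact: open_halfplane.
  by move=> a _; exact: continuous_translate.
have := compact_open_open (@compact_set1 _ p) oO.
move=> oK; exists (fun h : maps R n.+1 => h @` [set p] `<=` O) => //.
apply/seteqP; split => f /=.
  move=> H; rewrite in_itv/= andbT (extE _ Hz).
  by apply: (H (set_val f p)); exists p.
rewrite in_itv/= andbT (extE _ Hz) => H _ [_ -> <-].
exact: H.
Qed.

Lemma phase_real (u a b : R[i]) (r s : R) : normc u = 1 ->
  u * a = r%:C -> u * b = s%:C -> complex.Im (a * b^*) = 0.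
Proof.
move=> u1 ua ub; have uu : u * u^* = 1.
  by rewrite -sqr_normc normC u1 expr1n.
have -> : a * b^* = (u * u^*) * (a * b^*) by rewrite uu mul1r.
have -> : (u * u^*) * (a * b^*) = (u * a) * (u * b)^* by rewrite rmorphM; ring.
by rewrite ua ub /= oppr0 mulr0 mul0r addr0.
Qed.

(** * Integration against [mu] and the almost sure phase condition *)

Section barycenter_integral.
Variables (mu : probability (borelC R n.+1) R) (g : borelC R n.+1).
Hypothesis mu_g : forall z, Hn z ->
  complex_integral mu (fun f : borelC R n.+1 => ext (set_val f) z) = ext (set_val g) z.

Let Imf z : borelC R n.+1 -> R := fun f => complex.Im (ext (set_val f) z).

Lemma Rintegral_Im_ext z : Hn z -> \int[mu]_f Imf z f = Imf z g.
Proof. by move=> Hz; have := congr1 (@complex.Im R) (mu_g Hz). Qed.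

(* A nonnegative function whose integral is infinite has [Rintegral] equal to [0],
   whereas [Im g(z) > 0]. *)
Lemma integrable_Im_ext z : Hn z -> mu.-integrable setT (EFin \o Imf z).
Proof.
move=> Hz; apply/integrableP; split.
  apply/measurable_EFinP.
  exact: (measurable_Im_ext Hz).
have e f : `|(EFin \o Imf z) f|%E = (Imf z f)%:E.
  by rewrite /= ger0_norm// ltW// ext_halfplane.
under eq_integral do rewrite e.
rewrite ltey; apply/eqP => E.
have := Rintegral_Im_ext Hz; rewrite /Rintegral E /= => g0.
by have := ext_halfplane (set_val g) Hz; rewrite -/(Imf z g) -g0 ltxx.
Qed.

(** The barycenter hypothesis at the two points [z] and [w], combined linearly. *)
Lemma Rintegral_harnack_gap z u k : Hn z -> (forall j, normc (u 0 j) <= 1) ->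
  mu.-integrable setT (fun f : borelC R n.+1 => (harnack_gap (set_val f) z u k)%:E) /\
  \int[mu]_f harnack_gap (set_val f) z u k = harnack_gap (set_val g) z u k.
Proof.
move=> Hz u1; set w := moebius_disc z u (- (k.+2%:R^-1)%:C).
have Hw : Hn w.
  apply: moebius_disc_halfplane => //; rewrite normcN normcR ger0_norm//.
  by rewrite invf_lt1// ltr1n.
pose c : R := (1 - k.+2%:R^-1) ^+ 2.
have gapE (f : borelC R n.+1) : harnack_gap (set_val f) z u k = k.+2%:R * (Imf w f - c * Imf z f).
  by [].
have i1 := integrable_Im_ext Hw; have i2 := integrable_Im_ext Hz.
have i3 : mu.-integrable setT (EFin \o (fun f => c * Imf z f)).
  exact: (integrableZl measurableT c i2).
have i4 : mu.-integrable setT (EFin \o (fun f => Imf w f - c * Imf z f)).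
  exact: (integrableB measurableT i1 i3).
split.
  exact: (integrableZl measurableT k.+2%:R i4).
under eq_Rintegral do rewrite gapE.
by rewrite RintegralZl// RintegralB// RintegralZl// !Rintegral_Im_ext.
Qed.

Lemma ae_phase z : Hn z -> extremal (set_val g) ->
  \forall f \ae mu, forall j, complex.Im (partial (set_val f) j z * (partial (set_val g) j z)^*) = 0.
Proof.
move=> Hz [hg eg].
have hol (f : borelC R n.+1) : holomorphic (set_val f) by have [] := set_valP f.
have /choice[v vP] (j : 'I_n.+1) : exists c : R[i],
    normc c = 1 /\ c * partial (set_val g) j z = (normc (partial (set_val g) j z))%:C.
  by have [c] := rotation (partial (set_val g) j z); exists c.
pose u : 'rV[R[i]]_n.+1 := \row_j v j.
have uE j : normc (u 0 j) = 1 by rewrite mxE; have [] := vP j.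
have u1 j : normc (u 0 j) <= 1 by rewrite uE.
pose X k (f : borelC R n.+1) := (harnack_gap (set_val f) z u k)%:E.
pose Y (f : borelC R n.+1) := 2 * (complex.Im (ext (set_val f) z)
    - \sum_j complex.Im (z 0 j) * complex.Re (u 0 j * partial (set_val f) j z)).
have XY f : X k f @[k --> \oo] --> (Y f)%:E.
  by apply: cvg_EFin; [exact: nearW|exact: harnack_gap_cvg].
(* Extremality enters here: [u] is adapted to [g], so the real parts in [Y g] are the moduli in the
   definition of [extremal]. *)
have Yg : Y g = 0.
  have := eg z Hz => /(congr1 (@complex.Re R)) /= E.
  rewrite /Y -E raddf_sum -sumrB big1 ?mulr0// => j _.
  rewrite mxE (vP j).2 normC /=; ring.
have Y0 f : 0 <= Y f.
  by rewrite mulr_ge0// subr_ge0 schwarz_pick.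
have mX k : measurable_fun setT (X k).
  by have [/integrableP[]] := Rintegral_harnack_gap k Hz u1.
have intX k : (\int[mu]_f X k f = (harnack_gap (set_val g) z u k)%:E)%E.
  have [iX <-] := Rintegral_harnack_gap k Hz u1.
  by rewrite /Rintegral fineK//; exact: integrable_fin_num.
have X0 k f : setT f -> (0 <= X k f)%E by move=> _; rewrite lee_fin harnack_gap_ge0.
have limX f : limn_einf (X ^~ f) = (Y f)%:E by apply: (cvg_limn_einf_sup _).1; exact: XY.
(* By Fatou the integral of [Y] is at most the lower limit of the means of the gaps; these are the
   gaps of [g], which tend to [Y g = 0]. *)
have iY : (\int[mu]_f (Y f)%:E = 0)%E.
  apply/eqP; rewrite eq_le; apply/andP; split; last first.
    by apply: integral_ge0 => f _; rewrite lee_fin.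
  have := fatou mu measurableT mX X0.
  under eq_integral do rewrite limX.
  move=> /le_trans; apply.
  have -> : (fun k => \int[mu]_f X k f)%E = X ^~ g by apply/funext => k; rewrite intX.
  by rewrite limX Yg.
have mY : measurable_fun setT (fun f => (Y f)%:E).
  by apply: (emeasurable_fun_cvg X) => [k|f _]; [exact: mX|exact: XY].
have : ae_eq mu setT (fun f => (Y f)%:E) (cst 0%E).
  apply/(ae_eq_integral_abs _ measurableT mY).
  by rewrite -[RHS]iY; apply: eq_integral => f _; rewrite /= ger0_norm.
apply: filterS => f /(_ I) [Yf] j.
have eqf : \sum_j complex.Im (z 0 j) * complex.Re (u 0 j * partial (set_val f) j z)
    = complex.Im (ext (set_val f) z).
  move: Yf => /eqP; rewrite mulf_eq0 pnatr_eq0/= subr_eq0 => /eqP ->.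
  by [].
have fE := schwarz_pick_phase (hol f) Hz uE eqf j.
have gE : u 0 j * partial (set_val g) j z = (normc (partial (set_val g) j z))%:C.
  have uv : u 0 j = v j by rewrite mxE.
  exact: etrans (congr1 (fun c => c * partial (set_val g) j z) uv) (vP j).2.
exact: (phase_real (uE j) fE gE).
Qed.

End barycenter_integral.

(** * From a countable dense set to all points, and uniqueness *)

Definition rational_point (m : 'rV[rat * rat]_n.+1) : 'rV[R[i]]_n.+1 :=
  \row_j (ratr (m 0 j).1 +i* ratr (m 0 j).2).

(** Codes of no point of the polyhalfplane are sent to [(i, ..., i)], so that [ae_phase] applies to
    every term. *)
Definition dense_seq (k : nat) : 'rV[R[i]]_n.+1 :=
  if unpickle k is Some m then
    if `[< Hn (rational_point m) >] then rational_point m else const_mx 'i%C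
  else const_mx 'i%C.

Lemma const_i_halfplane : Hn (const_mx 'i%C).
Proof. by move=> j; rewrite /halfplane /= mxE /=. Qed.

Lemma dense_seq_halfplane k : Hn (dense_seq k).
Proof.
rewrite /dense_seq; case: unpickle => [m|]; last exact: const_i_halfplane.
by case: ifP => [/asboolP//|_]; exact: const_i_halfplane.
Qed.

Lemma rat_approx (x e : R) : 0 < e -> exists q : rat, `|ratr q - x| < e.
Proof.
move=> e0; have [q] : exists q : rat, ratr q \in `]x - e, x + e[.
  have xe : x - e < x + e by rewrite ltrBlDr -addrA ltrDl addr_gt0.
  by have [q qI] := rat_in_itvoo xe; exists q.
by rewrite in_itv/= => /andP[q1 q2]; exists q; rewrite ltr_distl q1.
Qed.

Lemma dense_seqP z r : Hn z -> 0 < r -> exists k, polydisc z r (dense_seq k).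
Proof.
move=> Hz r0.
have nH : nbhs z Hn by apply: open_nbhs_nbhs; split => //; exact: open_polyhalfplane.
have [s s0 sH] := nbhs_polydisc nH.
(* Staying within [s] keeps the rational point in the polyhalfplane, so [dense_seq] does not replace
   it; the half is shared between real and imaginary parts. *)
pose t : R := Num.min r s / 2; have t0 : 0 < t by rewrite divr_gt0// lt_min r0.
have /choice[m mP] (j : 'I_n.+1) : exists p : rat * rat,
    `|ratr p.1 - complex.Re (z 0 j)| < t /\ `|ratr p.2 - complex.Im (z 0 j)| < t.
  have [a aP] := rat_approx (complex.Re (z 0 j)) t0.
  by have [b bP] := rat_approx (complex.Im (z 0 j)) t0; exists (a, b).
have close : polydisc z (Num.min r s) (rational_point (\row_j m j)).
  move=> j; have [h1 h2] := mP j; rewrite !mxE.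
  move: h1 h2; case: (z 0 j) => x y h1 h2.
  apply: le_lt_trans (normc_le_ReIm _) _; rewrite (splitr (Num.min r s)).
  exact: ltrD.
exists (pickle (\row_j m j)); rewrite /dense_seq pickleK asboolT.
  by apply: polydiscW close; rewrite ge_min lexx.
by apply: sH; apply: polydiscW close; rewrite ge_min lexx orbT.
Qed.

Lemma conj_increment (a b c d : R[i]) e : e <= 1 -> normc (c - a) <= e -> normc (d - b) <= e ->
  complex.Im (c * d^*) = 0 -> `|complex.Im (a * b^*)| <= e * (normc a + normc b + 1).
Proof.
move=> e1 ca db cd.
have e0 : 0 <= e by apply: le_trans ca; exact: normc_ge0.
have nJ (x : R[i]) : normc x^* = normc x by apply: complexI; rewrite -!normC normcJ.
have dn : normc d <= normc b + 1.
  rewrite -(subrK b d) addrC; apply: le_trans (ler_normcD _ _) _.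
  by rewrite lerD2l (le_trans db).
have -> : complex.Im (a * b^*) = complex.Im (a * b^* - c * d^*) by rewrite raddfB /= cd subr0.
have -> : a * b^* - c * d^* = - ((c - a) * d^* + a * (d - b)^*) by rewrite rmorphB; ring.
apply: le_trans (normc_ge_Im _) _; rewrite normcN; apply: le_trans (ler_normcD _ _) _.
rewrite !normcM !nJ.
apply: le_trans (lerD (ler_pM (normc_ge0 _) (normc_ge0 _) ca dn)
                      (ler_wpM2l (normc_ge0 a) db)) _.
by rewrite le_eqVlt; apply/orP; left; apply/eqP; ring.
Qed.

Lemma phase_everywhere f g : 
  (forall k j, complex.Im (partial (set_val f) j (dense_seq k) *
                          (partial (set_val g) j (dense_seq k))^*) = 0) ->
  forall j z, Hn z -> complex.Im (partial (set_val f) j z * (partial (set_val g) j z)^*) = 0.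
Proof.
move=> H j z Hz.
have [hf _ _] := set_valP f; have [hg _ _] := set_valP g.
set a := partial (set_val f) j z; set b := partial (set_val g) j z.
apply/eqP; rewrite -normr_le0; apply/ler_addgt0Pr => e e0; rewrite add0r.
pose K : R := normc a + normc b + 1.
have K0 : 0 < K by rewrite ltr_wpDl// addr_ge0// normc_ge0.
pose d : R := Num.min 1 (e / K); have d0 : 0 < d by rewrite lt_min ltr01 divr_gt0.
have [r1 r10 H1] := partial_continuous j hf Hz d0.
have [r2 r20 H2] := partial_continuous j hg Hz d0.
have [k kP] := @dense_seqP z (Num.min r1 r2) Hz ltac:(by rewrite lt_min r10).
have c1 := H1 _ (polydiscW (ltac:(by rewrite ge_min lexx) : Num.min r1 r2 <= r1) kP).
have c2 := H2 _ (polydiscW (ltac:(by rewrite ge_min lexx orbT) : Num.min r1 r2 <= r2) kP).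
have d1 : d <= 1 by rewrite ge_min lexx.
apply: le_trans (conj_increment d1 c1 c2 (H k j)) _.
by rewrite -ler_pdivlMr// ge_min lexx orbT.
Qed.

Lemma phase_unique f g :
  (forall j z, Hn z -> complex.Im (partial (set_val f) j z * (partial (set_val g) j z)^*) = 0) ->
  f = g.
Proof.
move=> H; have [hf f1 f2] := set_valP f; have [hg g1 g2] := set_valP g.
have hi : halfplane R 'i%C by rewrite /halfplane /=.
have [r r0 rP] := @eq_near_center _ _ (set_val f) (set_val g) (const_mx 'i%C) hf hg
  const_i_halfplane H (fun j => etrans (f2 _ j hi) (esym (g2 _ j hi)))
  (fun j => eq_ind_r (fun a => a != 0) (invr_neq0 (ltac:(by rewrite pnatr_eq0) : n.+1%:R != 0 :> R[i])) (g2 _ j hi))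
  (etrans (f1 _ hi) (esym (g1 _ hi))).
have E := identity_polyhalfplane hf hg r0 rP.
apply: val_inj; apply/funext => p; apply: val_inj.
have := E _ (set_valP p); rewrite !(extE _ (set_valP p)).
have -> : SigSub (mem_set (set_valP p)) = p by apply: val_inj.
by [].
Qed.

End barycenter.

Local Close Scope complex_scope.
Unset Implicit Arguments.

Theorem proposition2p3 (R : realType) (n : nat) (g : borelC R n.+1)
    (g_extremal : extremal (set_val g))
    (mu : probability (borelC R n.+1) R)
    (mu_g : forall z : 'rV[R[i]]_n.+1, polyhalfplane R n.+1 z ->
      complex_integral mu (fun f : borelC R n.+1 => ext (set_val f) z)
      = ext (set_val g) z) :
  forall A : set (borelC R n.+1), measurable A -> mu A = \d_g A.
Proof.
have [N [mN N0 NP]] : \forall f \ae mu, forall k j, complex.Im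
    (partial (set_val f) j (dense_seq k) * Num.conj (partial (set_val g) j (dense_seq k))) = 0.
  by apply/ae_foralln => k; apply: ae_phase => //; exact: dense_seq_halfplane.
(* Outside [N] the phase condition holds on the dense set, which forces [f = g]; a set that misses
   [g] thus lies in [N]. *)
have null B : measurable B -> ~ B g -> mu B = 0%E.
  move=> mB Bg; apply: (subset_measure0 mB mN _ N0).
  move=> f Bf; apply: NP => /= H; apply: Bg.
  by rewrite -(phase_unique (phase_everywhere H)).
move=> A mA; rewrite diracE; have [Ag|Ag] := pselect (A g).
  rewrite (mem_set Ag) -[A]setCK probability_setC; last exact: measurableC.
  by rewrite null ?sube0//; exact: measurableC.
by rewrite memNset// null.
Qed.
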